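(* Let $E$ be a Banach lattice. The following hold. (i) The space $\text{r-a-LW}(E)$ of regularly a-LW-operators on $E$ is a subalgebra of $\mathrm{L}_r(E)$. Moreover, $\text{r-a-LW}(E)=\mathrm{L}_r(E)$ if and only if the identity operator $I_E$ belongs to $\text{a-LW}(E)$. (ii) If, additionally, $E$ is Dedekind complete, then $(\text{r-a-LW}(E),\|\cdot\|_{\text{r-a-LW}})$ is a closed Riesz subalgebra and an order ideal of the Banach lattice algebra $(\mathrm{L}_r(E),\|\cdot\|_r)$.
   Context: Vector spaces are real and operators are linear. A sequence $(x_n)$ in a Banach lattice is disjoint if $|x_n|\wedge|x_m|=0$ for $n\neq m$. For a subset $L$ of a Banach lattice, $\mathrm{sol}(L)$ is its solid hull. A bounded subset $L$ of a Banach lattice $F$ is an LW-set (LW-subset) if every disjoint sequence in $\mathrm{sol}(L)$ is norm null. An operator $T:X\to F$ from a Banach space to a Banach lattice is almost LW (a-LW) if it carries relatively weakly compact subsets of $X$ onto LW-subsets of $F$ (such operators are automatically bounded). $\text{a-LW}(E)$ is the set of a-LW-operators $E\to E$. An operator $T:E\to E$ is a regularly a-LW-operator, $T\in\text{r-a-LW}(E)$, if $T=T_1-T_2$ with $T_1,T_2$ positive a-LW-operators. $\mathrm{L}_r(E)$ is the space of regular operators on $E$ (differences of two positive operators), with composition as multiplication, the order $S\le T$ iff $T-S$ is positive, and the regular norm $\|T\|_r=\inf\{\|S\|:\pm T\le S\}$ (equal to $\|\,|T|\,\|$ when $E$ is Dedekind complete). The norm on $\text{r-a-LW}(E)$ is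 $\|T\|_{\text{r-a-LW}}=\inf\{\|S\|:\pm T\le S\in\text{a-LW}(E)\}$. A Riesz subalgebra is a subalgebra that is also a vector sublattice. *)

(* Defs.v *)
From HB Require Import structures.
From mathcomp Require Import all_boot all_order all_algebra.
From mathcomp Require Import all_classical all_reals all_analysis.

Set Implicit Arguments.
Unset Strict Implicit.
Unset Printing Implicit Defensive.

Import Order.TTheory GRing.Theory Num.Theory.
Import numFieldNormedType.Exports.

Local Open Scope classical_set_scope.
Local Open Scope ring_scope.

(* The order and the lattice operations are fields of their own: the order
   structures of MathComp cannot be joined with [CompleteNormedModule], as
   [Num.NumDomain] and [Num.RealDomain] inherit from both an order and a norm
   without going through such a join. *)
HB.mixin Record CompleteNormedModule_isBanachLattice (R : realType) E
    & CompleteNormedModule R E := {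
  bl_le : E -> E -> Prop ;
  bl_join : E -> E -> E ;
  bl_meet : E -> E -> E ;
  bl_lexx : forall x, bl_le x x ;
  bl_le_anti : forall x y, bl_le x y -> bl_le y x -> x = y ;
  bl_le_trans : forall y x z, bl_le x y -> bl_le y z -> bl_le x z ;
  bl_leUx : forall x y z, bl_le (bl_join x y) z <-> bl_le x z /\ bl_le y z ;
  bl_lexI : forall x y z, bl_le z (bl_meet x y) <-> bl_le z x /\ bl_le z y ;
  bl_leD2r : forall z x y, bl_le x y -> bl_le (x + z) (y + z) ;
  bl_scale_ge0 : forall (a : R) x, 0 <= a -> bl_le 0 x -> bl_le 0 (a *: x) ;
  bl_le_norm : forall x y,
    bl_le (bl_join x (- x)) (bl_join y (- y)) -> `|x| <= `|y|
}.

#[short(type="banachLatticeType")]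
HB.structure Definition BanachLattice (R : realType) :=
  {E of CompleteNormedModule R E & CompleteNormedModule_isBanachLattice R E}.

Notation "x <=E y" := (bl_le x y) (at level 70, y at next level).

(* [`|x|] is the norm of [x]; the modulus is [modulus x]. *)
Definition modulus (R : realType) (E : banachLatticeType R) (x : E) : E :=
  bl_join x (- x).

Definition dedekind_complete (R : realType) (E : banachLatticeType R) :=
  forall A : set E, A !=set0 -> (exists u, forall x, A x -> x <=E u) ->
  exists s : E, (forall x, A x -> x <=E s) /\
    forall u, (forall x, A x -> x <=E u) -> s <=E u.

Definition disjoint_seq (R : realType) (E : banachLatticeType R)
    (x : nat -> E) :=
  forall n m, n <> m -> bl_meet (modulus (x n)) (modulus (x m)) = 0.

Definition solid_hull (R : realType) (E : banachLatticeType R) (L : set E) :=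
  [set y | exists2 x, L x & modulus y <=E modulus x].

Definition LW_set (R : realType) (F : banachLatticeType R) (L : set F) :=
  bounded_set L /\
  forall x : nat -> F, disjoint_seq x -> range x `<=` solid_hull L ->
    x @ \oo --> (0 : F).

Definition dual (R : realType) (X : normedModType R) :=
  {f : {linear X -> R^o} | continuous f}.

(* The type [X] with the topology sigma(X, X'). *)
Definition weak_space (R : realType) (X : normedModType R) :=
  sup_topology (fun f : dual X =>
    Topological.on (initial_topology (sval f : X -> R^o))).

Definition relatively_weakly_compact (R : realType) (X : normedModType R)
    (A : set X) :=
  precompact (A : set (weak_space X)).

Definition aLW (R : realType) (X : completeNormedModType R)
    (F : banachLatticeType R) : set {linear X -> F} :=
  [set T | forall A : set X, relatively_weakly_compact A -> LW_set (T @` A)].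

(* Meaningful for bounded [T] only, [sup] being [0] on unbounded sets. *)
Definition opnorm (R : realType) (X Y : normedModType R) (T : X -> Y) : R :=
  sup [set `|T x| | x in [set x : X | `|x| <= 1]].

Section operators.
Context (R : realType) (E : banachLatticeType R).
Implicit Types (S T : E -> E) (A : set {linear E -> E}).

Definition positive_op T := forall x : E, 0 <=E x -> 0 <=E T x.

Definition op_le S T := positive_op (T \- S).

Definition regular_op : set {linear E -> E} :=
  [set T | exists T1 T2 : {linear E -> E},
    [/\ positive_op T1, positive_op T2 & T = T1 \- T2 :> (E -> E)]].

Definition raLW : set {linear E -> E} :=
  [set T | exists T1 T2 : {linear E -> E},
    [/\ positive_op T1 /\ aLW T1, positive_op T2 /\ aLW T2
      & T = T1 \- T2 :> (E -> E)]].

(* A linear [U] with [T <= U] and [- T <= U] is positive, hence bounded, so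
   that [opnorm] is meaningful in both norms. *)
Definition regular_norm T : R :=
  inf [set opnorm U | U in
    [set U : {linear E -> E} | op_le T U /\ op_le (\- T) U]].

Definition raLW_norm T : R :=
  inf [set opnorm U | U in
    [set U : {linear E -> E} | [/\ op_le T U, op_le (\- T) U & aLW U]]].

(* Suprema and infima are taken in the ordered space of regular operators. *)
Definition is_op_sup S T (U : {linear E -> E}) :=
  [/\ regular_op U, op_le S U, op_le T U &
    forall V : {linear E -> E},
      regular_op V -> op_le S V -> op_le T V -> op_le U V].

Definition is_op_inf S T (U : {linear E -> E}) :=
  [/\ regular_op U, op_le U S, op_le U T &
    forall V : {linear E -> E},
      regular_op V -> op_le V S -> op_le V T -> op_le V U].

Definition is_op_modulus T (U : {linear E -> E}) := is_op_sup T (\- T) U.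

Definition is_subspace A :=
  [/\ A `<=` regular_op,
      A \0,
      forall S T : {linear E -> E}, A S -> A T -> A (S \+ T)
    & forall (a : R) (T : {linear E -> E}), A T -> A (a \*: T)].

Definition is_subalgebra A :=
  is_subspace A /\
  forall S T : {linear E -> E}, A S -> A T -> A (S \o T).

Definition is_sublattice A :=
  forall S T : {linear E -> E}, A S -> A T ->
    (exists2 U, A U & is_op_sup S T U) /\ (exists2 U, A U & is_op_inf S T U).

Definition is_riesz_subalgebra A := is_subalgebra A /\ is_sublattice A.

Definition is_order_ideal A :=
  is_subspace A /\
  forall S T absS absT : {linear E -> E}, regular_op S -> A T ->
    is_op_modulus S absS -> is_op_modulus T absT -> op_le absS absT -> A S.

Definition is_closed A :=
  forall T : {linear E -> E}, regular_op T ->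
    (forall e : R, 0 < e ->
      exists2 S : {linear E -> E}, A S & regular_norm (T \- S) < e) ->
    A T.

End operators.

Arguments regular_op {R} E.
Arguments raLW {R} E.

(* Main.v *)
Require Import Defs.
From HB Require Import structures.
From mathcomp Require Import all_boot all_order all_algebra.
From mathcomp Require Import all_classical all_reals all_analysis.
From mathcomp Require Import lra.

(**
The heart of the matter is [aLW_modulus_approx]. Let [T] be a positive
a-LW-operator and [W] relatively weakly compact. Although the set of moduli
[|W|] may fail to be weakly compact, for every [e] there is a [b] such that
disjoint sequences in [[0, b]] are norm null and [T |x| <= b + r] with
[`|r| <= e] for all [x] in [W]. Any positive [S] that is below [T] up to an
operator of small norm then satisfies [|S x| <= S |x| <= b + small] on [W],
hence is a-LW ([aLW_dominated]).

To obtain [b], one first shows that [T (v n)] is norm null for disjoint [v n]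
with [0 <= v n <= pos (x n)], [x n] in [W] ([aLW_disjoint_null]). A gliding hump
in [l1] shows that [v] is weakly null ([weakly_compact_diagonal],
[disjoint_weakly_null]), so that [T (v n)] is a positive weakly null sequence in
an LW-set. Disjointification ([approx_order_bounded]) moves it, up to small
errors, into one interval [[0, u]] whose disjoint sequences are norm null. There
monotone sequences converge in norm ([LW_interval_monotone_cvg]), so limits
superior can be formed in norm, and a positive functional above multiples of
norming functionals of all the terms shows that weakly null positive sequences
are norm null ([LW_interval_weak_null]). Disjointification, now applied to [T]
on [W] and on [- W], turns [aLW_disjoint_null] into the bound by [b].

Given this, the theorem is order theoretic. Sums of a-LW-operators are a-LW by
the Riesz decomposition, and composites [S \o T] because a positive [T] is
bounded and so preserves weak compactness. In the Dedekind complete case the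
Riesz-Kantorovich formula provides positive parts; the positive part of a
difference [T - S] of regularly a-LW-operators is dominated by a positive
a-LW-operator, and so are the operators between [0] and [|T|], which gives the
sublattice and the ideal property. Both norms of [T] are the operator norm of
[|T|], an a-LW-operator. If [T] is a limit in regular norm, [T^+] and [T^-] are
dominated by positive a-LW-operators up to positive operators of small norm.
*)

Set Implicit Arguments.
Unset Strict Implicit.
Unset Printing Implicit Defensive.

Import Order.TTheory GRing.Theory Num.Theory.
Import numFieldNormedType.Exports.

Local Open Scope classical_set_scope.
Local Open Scope ring_scope.

(** * Vector lattice calculus *)

Definition pos (R : realType) (E : banachLatticeType R) (x : E) : E :=
  bl_join x 0.

Section vector_lattice.
Context (R : realType) (E : banachLatticeType R).
Implicit Types (x y z t a b c : E) (s : R).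

Lemma lev_trans y x z : x <=E y -> y <=E z -> x <=E z.
Proof. exact: bl_le_trans. Qed.

Lemma levD2r z x y : x <=E y -> x + z <=E y + z.
Proof. exact: bl_leD2r. Qed.

Lemma levBr x y : 0 <=E y - x <-> x <=E y.
Proof.
split=> h; first by have := levD2r x h; rewrite add0r subrK.
by have := levD2r (- x) h; rewrite subrr.
Qed.

Lemma levD x y z t : x <=E y -> z <=E t -> x + z <=E y + t.
Proof.
move=> xy zt; apply: (lev_trans (levD2r z xy)).
by rewrite ![y + _]addrC; apply: levD2r.
Qed.

Lemma levBl x y z : x - y <=E z <-> x <=E z + y.
Proof.
by split=> h; [have := levD2r y h; rewrite subrK
              | have := levD2r (- y) h; rewrite addrK].
Qed.

Lemma levBrDr x y z : x <=E y - z <-> x + z <=E y.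
Proof. by rewrite -levBl opprK. Qed.

Lemma levN x y : x <=E y -> - y <=E - x.
Proof. by move=> h; apply/levBr; rewrite opprK addrC; apply/levBr. Qed.

Lemma addv_ge0 x y : 0 <=E x -> 0 <=E y -> 0 <=E x + y.
Proof. by move=> h k; have := levD h k; rewrite addr0. Qed.

Lemma levDl x y : 0 <=E y -> x <=E x + y.
Proof. by move=> h; have := levD (bl_lexx x) h; rewrite addr0. Qed.

Lemma levDr x y : 0 <=E y -> x <=E y + x.
Proof. by rewrite addrC; exact: levDl. Qed.

Lemma levB_le x y : 0 <=E y -> x - y <=E x.
Proof. by move=> h; apply/levBl/levDl. Qed.

Lemma sumv_ge0 (I : Type) (r : seq I) (P : pred I) (F : I -> E) :
  (forall i, P i -> 0 <=E F i) -> 0 <=E \sum_(i <- r | P i) F i.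
Proof.
by move=> h; apply: (big_ind (fun x => 0 <=E x)) => //;
  [exact: bl_lexx | exact: addv_ge0].
Qed.

Lemma lev_sum (I : Type) (r : seq I) (P : pred I) (F G : I -> E) :
  (forall i, P i -> F i <=E G i) ->
  \sum_(i <- r | P i) F i <=E \sum_(i <- r | P i) G i.
Proof.
by move=> h; apply: (big_ind2 (fun x y => x <=E y)) => //;
  [exact: bl_lexx | move=> *; exact: levD].
Qed.

Lemma lev_wscale s x y : 0 <= s -> x <=E y -> s *: x <=E s *: y.
Proof.
by move=> s0 /levBr h; apply/levBr; rewrite -scalerBr; exact: bl_scale_ge0.
Qed.

Lemma lev_scale_le s (r : R) x : s <= r -> 0 <=E x -> s *: x <=E r *: x.
Proof.
by move=> sr h; apply/levBr; rewrite -scalerBl; apply: bl_scale_ge0;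
  rewrite // subr_ge0.
Qed.

Lemma lev_joinl x y : x <=E bl_join x y.
Proof. by have [] := (bl_leUx x y _).1 (bl_lexx _). Qed.

Lemma lev_joinr x y : y <=E bl_join x y.
Proof. by have [] := (bl_leUx x y _).1 (bl_lexx _). Qed.

Lemma lev_join x y z : x <=E z -> y <=E z -> bl_join x y <=E z.
Proof. by move=> *; apply/bl_leUx. Qed.

Lemma lev_meetl x y : bl_meet x y <=E x.
Proof. by have [] := (bl_lexI x y _).1 (bl_lexx _). Qed.

Lemma lev_meetr x y : bl_meet x y <=E y.
Proof. by have [] := (bl_lexI x y _).1 (bl_lexx _). Qed.

Lemma lev_meet x y z : z <=E x -> z <=E y -> z <=E bl_meet x y.
Proof. by move=> *; apply/bl_lexI. Qed.

Lemma joinvC x y : bl_join x y = bl_join y x.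
Proof.
by apply: bl_le_anti; apply: lev_join; (exact: lev_joinl || exact: lev_joinr).
Qed.

Lemma meetvC x y : bl_meet x y = bl_meet y x.
Proof.
by apply: bl_le_anti; apply: lev_meet; (exact: lev_meetl || exact: lev_meetr).
Qed.

Lemma joinvD x y z : bl_join (x + z) (y + z) = bl_join x y + z.
Proof.
apply: bl_le_anti.
  by apply: lev_join; apply: levD2r; [exact: lev_joinl | exact: lev_joinr].
rewrite -[X in _ <=E X](subrK z); apply: levD2r.
by apply: lev_join; rewrite -[X in X <=E _](addrK z); apply: levD2r;
  [exact: lev_joinl | exact: lev_joinr].
Qed.

Lemma meetvN x y : bl_meet x y = - bl_join (- x) (- y).
Proof.
apply: bl_le_anti.
  rewrite -[X in X <=E _]opprK; apply: levN; apply: lev_join; apply: levN;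
  [exact: lev_meetl | exact: lev_meetr].
apply: lev_meet; rewrite -[X in _ <=E X]opprK; apply: levN;
  [exact: lev_joinl | exact: lev_joinr].
Qed.

Lemma meetvD x y z : bl_meet (x + z) (y + z) = bl_meet x y + z.
Proof. by rewrite !meetvN !opprD joinvD opprD opprK. Qed.

Lemma joinv_meet x y : bl_join x y + bl_meet x y = x + y.
Proof.
rewrite meetvN; apply/eqP; rewrite subr_eq addrC -joinvD.
by rewrite addKr [x + y]addrC addKr joinvC.
Qed.

Lemma joinv_scale s x y : 0 <= s ->
  bl_join (s *: x) (s *: y) = s *: bl_join x y.
Proof.
move=> s0; have [->|sn0] := eqVneq s 0.
  by rewrite !scale0r; apply: bl_le_anti;
    [apply: lev_join; exact: bl_lexx | exact: lev_joinl].
apply: bl_le_anti.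
  by apply: lev_join; apply: lev_wscale => //;
    [exact: lev_joinl | exact: lev_joinr].
rewrite -[X in _ <=E X](scalerKV sn0); apply: lev_wscale => //.
by apply: lev_join; rewrite -[X in X <=E _](scalerK sn0);
  apply: lev_wscale; rewrite ?invr_ge0 //;
  [exact: lev_joinl | exact: lev_joinr].
Qed.

Lemma meetv_scale s x y : 0 <= s ->
  bl_meet (s *: x) (s *: y) = s *: bl_meet x y.
Proof. by move=> s0; rewrite !meetvN -!scalerN joinv_scale // scalerN. Qed.

Lemma lev_meet2 x y z t : x <=E y -> z <=E t -> bl_meet x z <=E bl_meet y t.
Proof.
move=> h k; apply: lev_meet.
  exact: lev_trans (lev_meetl _ _) h.
exact: lev_trans (lev_meetr _ _) k.
Qed.

Lemma meetv_ge0 x y : 0 <=E x -> 0 <=E y -> 0 <=E bl_meet x y.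
Proof. by move=> *; apply: lev_meet. Qed.

Lemma meetvDr a b c : 0 <=E a -> 0 <=E b -> 0 <=E c ->
  bl_meet a (b + c) <=E bl_meet a b + bl_meet a c.
Proof.
move=> a0 b0 c0; rewrite -meetvD; apply: lev_meet.
  by apply: (lev_trans (lev_meetl _ _)); apply: levDl; exact: meetv_ge0.
rewrite [b + bl_meet _ _]addrC -meetvD; apply: lev_meet; last first.
  by apply: (lev_trans (lev_meetr _ _)); rewrite addrC; exact: bl_lexx.
by apply: (lev_trans (lev_meetl _ _)); exact: levDl.
Qed.

Lemma meetv_sum a (I : Type) (r : seq I) (F : I -> E) : 0 <=E a ->
  (forall i, 0 <=E F i) ->
  bl_meet a (\sum_(i <- r) F i) <=E \sum_(i <- r) bl_meet a (F i).
Proof.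
move=> a0 F0; elim: r => [|i r ih]; first by rewrite !big_nil; exact: lev_meetr.
rewrite !big_cons; apply: (lev_trans (meetvDr _ _ _)) => //.
  by apply: sumv_ge0.
by apply: levD => //; exact: bl_lexx.
Qed.

Lemma pos_ge0 x : 0 <=E pos x. Proof. exact: lev_joinr. Qed.

Lemma lev_pos x : x <=E pos x. Proof. exact: lev_joinl. Qed.

Lemma pos_le x y : x <=E y -> 0 <=E y -> pos x <=E y.
Proof. exact: lev_join. Qed.

Lemma pos_id x : 0 <=E x -> pos x = x.
Proof.
move=> h; apply: bl_le_anti; last exact: lev_pos.
by apply: pos_le => //; exact: bl_lexx.
Qed.

Lemma pos_mono x y : x <=E y -> pos x <=E pos y.
Proof.
move=> h; apply: pos_le (pos_ge0 _).
exact: lev_trans (h) (lev_pos _).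
Qed.

Lemma posD x y : pos (x + y) <=E pos x + pos y.
Proof.
by apply: pos_le; [apply: levD; exact: lev_pos | apply: addv_ge0; exact: pos_ge0].
Qed.

Lemma posBpos x : pos x - pos (- x) = x.
Proof.
have := joinv_meet x 0; rewrite addr0 meetvN oppr0 => {3}<-.
by [].
Qed.

Lemma meet_pos_neg x : bl_meet (pos x) (pos (- x)) = 0.
Proof.
have {1}-> : pos x = x + pos (- x) by rewrite -{2}(posBpos x) subrK.
rewrite -{2}[pos (- x)]add0r meetvD meetvN oppr0 -/(pos (- x)).
by rewrite addNr.
Qed.

Lemma pos_scale s x : 0 <= s -> pos (s *: x) = s *: pos x.
Proof. by move=> s0; rewrite /pos -{1}(scaler0 _ s) joinv_scale. Qed.

(** The Riesz decomposition used throughout: [x] splits into a part below [y]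
    and its excess over [y]. *)
Lemma meet_posB x y : bl_meet x y + pos (x - y) = x.
Proof.
rewrite /pos; have -> : bl_join (x - y) 0 = bl_join x y - y.
  by rewrite -joinvD subrr.
by rewrite addrA [_ + bl_join _ _]addrC joinv_meet addrK.
Qed.

Lemma modulusE x : modulus x = pos x + pos (- x).
Proof.
have -> : pos (- x) = pos x - x by rewrite -{3}(posBpos x) opprB addrC subrK.
rewrite addrA -mulr2n -scaler_nat -pos_scale ?ler0n // scaler_nat mulr2n.
by rewrite /pos -joinvD addrK add0r.
Qed.

Lemma modulus_ge0 x : 0 <=E modulus x.
Proof. by rewrite modulusE; apply: addv_ge0; exact: pos_ge0. Qed.

Lemma lev_modulus x : x <=E modulus x. Proof. exact: lev_joinl. Qed.

Lemma levN_modulus x : - x <=E modulus x. Proof. exact: lev_joinr. Qed.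

Lemma modulus_le x y : x <=E y -> - x <=E y -> modulus x <=E y.
Proof. exact: lev_join. Qed.

Lemma modulusN x : modulus (- x) = modulus x.
Proof. by rewrite /modulus opprK joinvC. Qed.

Lemma modulus_id x : 0 <=E x -> modulus x = x.
Proof.
move=> h; apply: bl_le_anti; last exact: lev_modulus.
apply: modulus_le; first exact: bl_lexx.
by apply: (lev_trans _ h); have := levN h; rewrite oppr0.
Qed.

Lemma modulusD x y : modulus (x + y) <=E modulus x + modulus y.
Proof.
apply: modulus_le; first by apply: levD; exact: lev_modulus.
by rewrite opprD; apply: levD; exact: levN_modulus.
Qed.

Lemma modulus_scale s x : modulus (s *: x) = `|s| *: modulus x.
Proof.
have [s0|s0] := lerP 0 s.
  by rewrite /modulus -scalerN joinv_scale // ger0_norm.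
rewrite -[s]opprK scaleNr modulusN /modulus -scalerN joinv_scale ?oppr_ge0 ?ltW//.
by rewrite normrN gtr0_norm // oppr_gt0.
Qed.

Lemma pos_le_modulus x : pos x <=E modulus x.
Proof. by rewrite modulusE; apply: levDl; exact: pos_ge0. Qed.

Lemma norm_modulus x : `|modulus x| = `|x|.
Proof.
apply/eqP; rewrite eq_le; apply/andP; split; apply: bl_le_norm;
by rewrite -!/(modulus _) (modulus_id (modulus_ge0 x)); exact: bl_lexx.
Qed.

Lemma lev_norm x y : 0 <=E x -> x <=E y -> `|x| <= `|y|.
Proof.
move=> x0 xy; apply: bl_le_norm; rewrite -!/(modulus _) modulus_id //.
exact: lev_trans xy (lev_modulus _).
Qed.

Lemma lev_modulus_norm x y : modulus x <=E y -> `|x| <= `|y|.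
Proof.
move=> xy; rewrite -norm_modulus; apply: lev_norm => //.
exact: modulus_ge0.
Qed.

Lemma norm_pos x : `|pos x| <= `|x|.
Proof.
rewrite -[X in _ <= X]norm_modulus; apply: lev_norm (pos_ge0 _) _.
exact: pos_le_modulus.
Qed.

Lemma disjoint_le a b x y : 0 <=E x -> x <=E a -> 0 <=E y -> y <=E b ->
  bl_meet a b = 0 -> bl_meet x y = 0.
Proof.
move=> x0 xa y0 yb ab; apply: bl_le_anti; last exact: meetv_ge0.
by rewrite -ab; exact: lev_meet2.
Qed.

Lemma disjoint_scale a b s (r : R) : 0 <=E a -> 0 <=E b -> 0 <= s -> 0 <= r ->
  bl_meet a b = 0 -> bl_meet (s *: a) (r *: b) = 0.
Proof.
move=> a0 b0 s0 r0 ab.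
have m0 : 0 <= Num.max s r by rewrite le_max s0.
apply: (@disjoint_le (Num.max s r *: a) (Num.max s r *: b)).
- exact: bl_scale_ge0.
- by apply: lev_scale_le => //; rewrite le_max lexx.
- exact: bl_scale_ge0.
- by apply: lev_scale_le => //; rewrite le_max lexx orbT.
- by rewrite meetv_scale // ab scaler0.
Qed.

Lemma disjointD_le a b x : bl_meet a b = 0 -> a <=E x -> b <=E x ->
  a + b <=E x.
Proof.
by move=> ab ax bx; rewrite -joinv_meet ab addr0; exact: lev_join.
Qed.

Lemma disjoint_sum_le (y : nat -> E) x (n : nat) :
  0 <=E x -> (forall i, 0 <=E y i) -> (forall i, y i <=E x) ->
  (forall i j, i <> j -> bl_meet (y i) (y j) = 0) ->
  \sum_(i < n) y i <=E x.
Proof.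
move=> x0 y0 yx dy.
suff [] : \sum_(i < n) y i <=E x /\
    (forall j, (n <= j)%N -> bl_meet (y j) (\sum_(i < n) y i) = 0) by [].
elim: n => [|n [ihx ihd]].
  rewrite big_ord0; split=> // j _; apply: bl_le_anti; first exact: lev_meetr.
  by apply: meetv_ge0 => //; exact: bl_lexx.
rewrite big_ord_recr /=; split.
  by apply: disjointD_le => //; rewrite meetvC; exact: ihd.
move=> j nj; apply: bl_le_anti; last first.
  by apply: meetv_ge0 => //; apply: addv_ge0 => //; apply: sumv_ge0.
apply: (lev_trans (meetvDr _ _ _)) => //; first by apply: sumv_ge0.
rewrite ihd ?(ltnW nj) // dy ?addr0; first exact: bl_lexx.
by move=> jn; rewrite jn ltnn in nj.
Qed.

Lemma lev_posB x a b : x <=E a + b -> 0 <=E b -> pos (x - a) <=E b.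
Proof. by move=> h b0; apply: pos_le => //; apply/levBl; rewrite addrC. Qed.

(** The norm of [pos (- y)] is at most the distance from [y] to any positive
    vector. *)
Lemma pos_cvg_ge0 (x : nat -> E) y : x @ \oo --> y ->
  (forall n, 0 <=E x n) -> 0 <=E y.
Proof.
move=> xy x0; suff /eqP h : `|pos (- y)| == 0.
  rewrite -(posBpos y) (normr0_eq0 h) subr0.
  exact: pos_ge0.
rewrite -normr_le0 normr_id; apply/ler_addgt0Pl => e e0; rewrite addr0.
move/cvgrPdist_lt : xy => /(_ _ e0)[N _ /(_ N (leqnn N))] xNe.
apply: le_trans (ltW xNe); rewrite distrC.
apply: le_trans (norm_pos _); apply: lev_norm (pos_ge0 _) _.
by apply: pos_mono; apply: levDr.
Qed.

Lemma lev_cvg (x y : nat -> E) a b : x @ \oo --> a -> y @ \oo --> b ->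
  (forall n, x n <=E y n) -> a <=E b.
Proof.
move=> xa yb xy; apply/levBr; apply: (@pos_cvg_ge0 (y \- x)).
  exact: cvgB.
by move=> n; apply/levBr.
Qed.

End vector_lattice.

(** * Riesz-Kantorovich formulas *)

(** An additive and positively homogeneous map on the positive cone extends
    linearly, as every vector is a difference of positive ones. *)
Lemma linear_extension_cone (R : realType) (E : banachLatticeType R)
    (F : lmodType R) (phi : E -> F) :
  (forall x y, 0 <=E x -> 0 <=E y -> phi (x + y) = phi x + phi y) ->
  (forall s x, 0 <= s -> 0 <=E x -> phi (s *: x) = s *: phi x) ->
  exists P : {linear E -> F}, forall x, 0 <=E x -> P x = phi x.
Proof.
move=> phiD phiZ; pose f x := phi (pos x) - phi (pos (- x)).
have fE a b : 0 <=E a -> 0 <=E b -> f (a - b) = phi a - phi b.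
  move=> a0 b0; rewrite /f; apply/eqP; rewrite subr_eq addrAC eq_sym subr_eq.
  rewrite -!phiD //; try exact: pos_ge0.
  have pE : pos (a - b) = a - b + pos (- (a - b)).
    by rewrite -{2}(posBpos (a - b)) subrK.
  by rewrite pE addrAC subrK.
have f0 x : 0 <=E x -> f x = phi x.
  move=> x0; have phi0 : phi 0 = 0.
    by have := phiZ 0 0 (lexx _) (bl_lexx _); rewrite !scale0r.
  by have := fE x 0 x0 (bl_lexx _); rewrite !subr0 phi0 subr0.
have lf : linear f.
  have fD x y : f (x + y) = f x + f y.
    rewrite -{1}(posBpos x) -{1}(posBpos y) addrACA -opprD fE; last 2 first.
    - by apply: addv_ge0; exact: pos_ge0.
    - by apply: addv_ge0; exact: pos_ge0.
    rewrite !phiD; try exact: pos_ge0.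
    by rewrite /f opprD addrACA.
  have fN x : f (- x) = - f x by rewrite /f opprK opprB.
  have fZ s x : 0 <= s -> f (s *: x) = s *: f x.
    move=> s0; rewrite -{1}(posBpos x) scalerBr fE;
      try exact: bl_scale_ge0 (pos_ge0 _).
    rewrite !phiZ //; try exact: pos_ge0.
    by rewrite scalerBr.
  move=> s x y; rewrite fD; congr (_ + _).
  have [s0|/ltW s0] := lerP 0 s; first exact: fZ.
  by rewrite -[s]opprK scaleNr fN fZ ?oppr_ge0 // [in RHS]scaleNr.
pose P : {linear E -> F} := HB.pack f (GRing.isLinear.Build _ _ _ _ f lf).
by exists P.
Qed.

Definition cone_ideal (R : realType) (E : banachLatticeType R) (I : set E) :=
  [/\ I 0, forall x y, I x -> I y -> I (x + y),
      forall s x, 0 <= s -> I x -> I (s *: x)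
    & forall x y, 0 <=E x -> x <=E y -> I y -> I x].

(** With [I] the whole space this is the positive part of [T]; with [I] the
    ideal generated by a single vector it is the part of [T] that lives on that
    vector. *)
Lemma riesz_kantorovich (R : realType) (E F : banachLatticeType R)
    (T : {linear E -> F}) (I : set E) :
  dedekind_complete F -> cone_ideal I ->
  (forall x, 0 <=E x ->
    exists u, forall y, 0 <=E y -> y <=E x -> I y -> T y <=E u) ->
  exists P : {linear E -> F}, forall x, 0 <=E x ->
    (forall y, 0 <=E y -> y <=E x -> I y -> T y <=E P x) /\
    (forall u, (forall y, 0 <=E y -> y <=E x -> I y -> T y <=E u) ->
      P x <=E u).
Proof.
move=> dF [I0 ID IZ Isolid] Tb.
pose A x := [set T y | y in [set y | [/\ 0 <=E y, y <=E x & I y]]].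
have : forall x, exists s, 0 <=E x -> (forall z, A x z -> z <=E s) /\
    (forall u, (forall z, A x z -> z <=E u) -> s <=E u).
  move=> x; have [x0|nx0] := pselect (0 <=E x); last by exists 0.
  have [||s hs] := dF (A x).
  - by exists (T 0); exists 0 => //; split => //; exact: bl_lexx.
  - have [u hu] := Tb x x0; exists u => _ [y [y0 yx Iy] <-]; exact: hu.
  - by exists s.
move=> /choice[phi phiP].
have ub x y : 0 <=E x -> 0 <=E y -> y <=E x -> I y -> T y <=E phi x.
  by move=> x0 y0 yx Iy; apply: (phiP x x0).1; exists y.
have lub x u : 0 <=E x ->
    (forall y, 0 <=E y -> y <=E x -> I y -> T y <=E u) -> phi x <=E u.
  by move=> x0 h; apply: (phiP x x0).2 => _ [y [y0 yx Iy] <-]; exact: h.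
(* A vector of [I] below [x + y] splits into vectors of [I] below [x] and [y]. *)
have phiD x y : 0 <=E x -> 0 <=E y -> phi (x + y) = phi x + phi y.
  move=> x0 y0; have xy0 := addv_ge0 x0 y0; apply: bl_le_anti.
    apply: (lub) => // z z0 zxy Iz; rewrite -(meet_posB z x) linearD.
    apply: levD; apply: (ub) => //.
    - exact: meetv_ge0.
    - exact: lev_meetr.
    - by apply: Isolid Iz; [exact: meetv_ge0 | exact: lev_meetl].
    - exact: pos_ge0.
    - exact: lev_posB.
    - apply: Isolid Iz; first exact: pos_ge0.
      by apply: pos_le => //; exact: levB_le.
  apply/levBrDr; apply: (lub) => // z z0 zx Iz.
  apply/levBrDr; rewrite addrC; apply/levBrDr; apply: (lub) => // t t0 ty It.
  apply/levBrDr; rewrite -linearD; apply: (ub) => //.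
  - exact: addv_ge0.
  - by rewrite addrC; exact: levD.
  - exact: ID.
have phiZle s x : 0 < s -> 0 <=E x -> s *: phi x <=E phi (s *: x).
  move=> s0 x0; have sx0 : 0 <=E s *: x by apply: bl_scale_ge0 => //; exact: ltW.
  have sn0 : s != 0 by rewrite gt_eqF.
  rewrite -[X in _ <=E X](scalerKV sn0); apply: lev_wscale; first exact: ltW.
  apply: (lub) => // y y0 yx Iy; rewrite -[X in X <=E _](scalerK sn0).
  apply: lev_wscale; first by rewrite invr_ge0 ltW.
  rewrite -linearZ /=; apply: (ub) => //.
  - by apply: bl_scale_ge0 => //; exact: ltW.
  - by apply: lev_wscale => //; exact: ltW.
  - by apply: IZ => //; exact: ltW.
have phiZ s x : 0 <= s -> 0 <=E x -> phi (s *: x) = s *: phi x.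
  move=> s0 x0; have [->|sn0] := eqVneq s 0.
    rewrite !scale0r.
    by apply: (addrI (phi 0)); rewrite -phiD ?addr0 //; exact: bl_lexx.
  have {sn0 s0} s0 : 0 < s by rewrite lt_def sn0.
  apply: bl_le_anti; last exact: phiZle.
  have sn0 : s != 0 by rewrite gt_eqF.
  rewrite -[X in X <=E _](scalerKV sn0); apply: lev_wscale; first exact: ltW.
  rewrite -[X in _ <=E phi X](scalerK sn0); apply: phiZle; rewrite ?invr_gt0 //.
  by apply: bl_scale_ge0 => //; exact: ltW.
have [P PE] := linear_extension_cone phiD phiZ.
exists P => x x0; rewrite PE //; split=> [y|u]; [exact: ub | exact: lub].
Qed.

(** The scalars form a Dedekind complete Banach lattice, so that functionals are
    a special case of operators. *)
Section scalar_lattice.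
Context (R : realType).

Let real_leUx (x y z : R) : Num.max x y <= z <-> x <= z /\ y <= z.
Proof. by rewrite ge_max; split=> /andP. Qed.

Let real_lexI (x y z : R) : z <= Num.min x y <-> z <= x /\ z <= y.
Proof. by rewrite le_min; split=> /andP. Qed.

Let real_le_norm (x y : R) :
  Num.max x (- x) <= Num.max y (- y) -> `|x : R^o| <= `|y : R^o|.
Proof. by rewrite !maxrN. Qed.

Let real_le_anti (x y : R) : x <= y -> y <= x -> x = y.
Proof. by move=> xy yx; apply: le_anti; rewrite xy. Qed.

Let real_le_trans (y x z : R) : x <= y -> y <= z -> x <= z.
Proof. exact: le_trans. Qed.

Let real_leD2r (z x y : R) : x <= y -> x + z <= y + z.
Proof. by rewrite lerD2r. Qed.

HB.instance Definition _ := @CompleteNormedModule_isBanachLattice.Build R R^o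
  (fun x y : R => x <= y) (fun x y : R => Num.max x y)
  (fun x y : R => Num.min x y) (fun x : R => lexx x) real_le_anti
  real_le_trans real_leUx real_lexI real_leD2r (fun a x => @mulr_ge0 R a x)
  real_le_norm.

Lemma real_dedekind_complete : dedekind_complete (R^o : banachLatticeType R).
Proof.
move=> A A0 Aub; exists (sup (A : set R)); split=> [x Ax|u hu].
  by apply: ub_le_sup.
exact: ge_sup.
Qed.

End scalar_lattice.

(** * The Hahn-Banach theorem *)

Section hahn_banach.
Context (R : realType) (X : lmodType R).
Implicit Types (p q : X -> R) (x y : X) (s : R).

Definition sublinear q :=
  (forall x y, q (x + y) <= q x + q y) /\
  (forall s x, 0 <= s -> q (s *: x) <= s * q x).

Lemma sublinearZ q s x : sublinear q -> 0 <= s -> q (s *: x) = s * q x.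
Proof.
move=> [qD qZ] s0; apply/eqP; rewrite eq_le qZ //=.
have [->|sn0] := eqVneq s 0.
  by rewrite mul0r scale0r; have := qD 0 0; rewrite addr0 -lerBlDl subrr.
rewrite -ler_pdivlMl ?lt_def ?sn0 // -{1}[x](scalerK sn0).
by apply: qZ; rewrite invr_ge0.
Qed.

Lemma sublinear0 q : sublinear q -> q 0 = 0.
Proof. by move=> h; rewrite -(scale0r 0) sublinearZ // mul0r. Qed.

Lemma sublinear_lb q x : sublinear q -> - q (- x) <= q x.
Proof.
move=> qs; have := qs.1 x (- x); rewrite subrr sublinear0 // => h.
by rewrite -subr_ge0 opprK.
Qed.

(** The infimum of [slope q y x] is the value at [x] of the largest sublinear
    functional below [q] that is at most [- q y] at [- y]. *)
Let slope q y x := [set q (x + t *: y) - t * q y | t in [set t : R | 0 <= t]].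

Let slope_inf q y x := inf (slope q y x).

Let slope_lb q y x : sublinear q -> lbound (slope q y x) (- q (- x)).
Proof.
move=> qs _ [t t0 <-]; rewrite lerBrDr addrC lerBlDr.
rewrite -sublinearZ //.
by have := qs.1 (x + t *: y) (- x); rewrite [_ + - x]addrC addKr.
Qed.

Let slope_inf_le q y x t : sublinear q -> 0 <= t ->
  slope_inf q y x <= q (x + t *: y) - t * q y.
Proof.
move=> qs t0; apply: ge_inf; last by exists t.
by exists (- q (- x)); exact: slope_lb.
Qed.

Let le_slope_inf q y x c : (forall t, 0 <= t -> c <= q (x + t *: y) - t * q y) ->
  c <= slope_inf q y x.
Proof.
move=> h; apply: lb_le_inf;
  first by exists (q (x + 0 *: y) - 0 * q y); exists 0; rewrite /= ?lexx.
by move=> _ [t t0 <-]; exact: h.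
Qed.

Let slope_infW q y x : sublinear q -> slope_inf q y x <= q x.
Proof.
move=> qs; have := slope_inf_le y x qs (lexx 0).
by rewrite scale0r mul0r addr0 subr0.
Qed.

Let slope_sublinear q y : sublinear q -> sublinear (slope_inf q y).
Proof.
move=> qs; split=> [x z|s x s0].
  rewrite -lerBlDr; apply: le_slope_inf => t t0; rewrite lerBlDr -lerBlDl.
  apply: le_slope_inf => r r0; rewrite lerBlDl.
  apply: (le_trans (slope_inf_le _ _ qs (addr_ge0 t0 r0))).
  rewrite mulrDl opprD addrACA lerD2r scalerDl addrACA; exact: qs.1.
have [->|sn0] := eqVneq s 0.
  rewrite scale0r mul0r; apply: (le_trans (slope_infW _ _ qs)).
  by rewrite sublinear0.
have {sn0}s0' : 0 < s by rewrite lt_def sn0.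
rewrite -ler_pdivrMl //; apply: le_slope_inf => t t0; rewrite ler_pdivrMl //.
apply: (le_trans (slope_inf_le _ _ qs (mulr_ge0 s0 t0))).
by rewrite mulrBr mulrA -(@sublinearZ q s (x + t *: y)) // scalerDr scalerA.
Qed.

(** By Zorn's lemma, as the pointwise infimum of a chain of sublinear functionals
    is sublinear. *)
Let minimal_sublinear p : sublinear p ->
  exists q, [/\ sublinear q, forall x, q x <= p x &
    forall r, sublinear r -> (forall x, r x <= q x) -> r = q].
Proof.
move=> ps.
pose S := {q | sublinear q /\ forall x, q x <= p x}.
pose below (q r : S) := `[< forall x, sval r x <= sval q x >].
have [||||[q [qs qp]] qmin] := @Zorn S below.
- by move=> q; apply/asboolP.
- move=> q r s /asboolP qr /asboolP rs; apply/asboolP => x.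
  exact: le_trans (rs x) (qr x).
- move=> [q hq] [r hr] /asboolP /= qr /asboolP /= rq; apply/eq_exist/funext => x.
  by apply/eqP; rewrite eq_le qr rq.
- move=> A Atot; have [[q0 Aq0]|A0] := pselect (A !=set0); last first.
    exists (exist _ p (conj ps (fun x => lexx (p x)))) => q Aq.
    by case: A0; exists q.
  pose m x := inf [set sval q x | q in A].
  have m_lb x : has_inf [set sval q x | q in A].
    split; first by exists (sval q0 x); exists q0.
    exists (- p (- x)) => _ [[q [qs qp]] _ <-] /=.
    by apply: (le_trans _ (sublinear_lb x qs)); rewrite lerN2.
  have mle (r : S) x : A r -> m x <= sval r x.
    by move=> Ar; apply: ge_inf; [exact: (m_lb x).2 | exists r].
  have lem c x : (forall r : S, A r -> c <= sval r x) -> c <= m x.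
    move=> h; apply: lb_le_inf; first by exists (sval q0 x); exists q0.
    by move=> _ [q Aq <-]; exact: h.
  have ms : sublinear m.
    split=> [x y|s x s0].
      rewrite -lerBlDr; apply: (lem) => q Aq; rewrite lerBlDr -lerBlDl.
      apply: (lem) => r Ar; rewrite lerBlDl.
      have [/asboolP qr|/asboolP rq] := Atot q r Aq Ar.
        apply: (le_trans (mle r _ Ar)); apply: (le_trans ((svalP r).1.1 _ _)).
        by rewrite lerD2r.
      apply: (le_trans (mle q _ Aq)); apply: (le_trans ((svalP q).1.1 _ _)).
      by rewrite lerD2l.
    have [->|sn0] := eqVneq s 0.
      rewrite mul0r; apply: (le_trans (mle _ _ Aq0)).
      by rewrite sublinearZ ?mul0r //; exact: (svalP q0).1.
    have {sn0 s0}s0 : 0 < s by rewrite lt_def sn0.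
    rewrite -ler_pdivrMl //; apply: lem => q Aq; rewrite ler_pdivrMl //.
    rewrite -sublinearZ; [exact: mle | exact: (svalP q).1 | exact: ltW].
  have mp x : m x <= p x by apply: (le_trans (mle _ _ Aq0)); exact: (svalP q0).2.
  by exists (exist _ m (conj ms mp)) => q Aq; apply/asboolP => x; exact: mle.
exists q; split=> // r rs rq.
have rp x : r x <= p x by exact: le_trans (rq x) (qp x).
by have [] := qmin (exist _ r (conj rs rp)) (introT (asboolP _) rq).
Qed.

(** A minimal sublinear functional [q] is linear: the functional
    [slope_inf q y] lies below [q], hence equals it, which makes [q] additive.
    Choosing [q] below [slope_inf p x0] forces the value at [x0]. *)
Theorem hahn_banach p x0 : sublinear p ->
  exists2 f : {linear X -> R^o}, (forall x, f x <= p x) & f x0 = p x0.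
Proof.
move=> ps; have [q [qs qp qmin]] := minimal_sublinear (slope_sublinear x0 ps).
have qD x y : q (x + y) = q x + q y.
  apply/eqP; rewrite eq_le qs.1 /= -lerBrDr.
  have {1}<- : slope_inf q y = q.
    by apply: qmin; [exact: slope_sublinear | move=> z; exact: slope_infW].
  by have := slope_inf_le y x qs ler01; rewrite scale1r mul1r.
have qN x : q (- x) = - q x.
  by apply/eqP; rewrite -addr_eq0 -qD addNr sublinear0.
have ql : linear (q : X -> R^o).
  move=> s x y; rewrite qD; congr (_ + _).
  have [s0|/ltW s0] := lerP 0 s; first by rewrite sublinearZ.
  rewrite -[s]opprK scaleNr qN sublinearZ ?oppr_ge0 //.
  by rewrite -mulNr.
pose f : {linear X -> R^o} := HB.pack (q : X -> R^o)
  (GRing.isLinear.Build _ _ _ _ (q : X -> R^o) ql).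
have fp x : q x <= p x by apply: (le_trans (qp x)); exact: slope_infW.
exists f => //=; apply/eqP; rewrite eq_le fp /= -lerN2 -qN.
apply: (le_trans (qp _)); apply: (le_trans (slope_inf_le _ _ ps ler01)).
by rewrite scale1r addNr sublinear0 // sub0r mul1r.
Qed.

End hahn_banach.

Section norming_functionals.
Context (R : realType).

Lemma dual_of_bound (X : normedModType R) (f : {linear X -> R^o}) (C : R) :
  (forall x, `|f x| <= C * `|x|) -> {g : dual X | forall x, sval g x = f x}.
Proof.
move=> fC; suff fc : continuous f by exists (exist _ f fc).
apply: bounded_linear_continuous; apply/linear_boundedP.
by near=> r => x; apply: (le_trans (fC x)); rewrite ler_wpM2r.
Unshelve. all: by end_near. Qed.

Lemma norming_functional (X : normedModType R) (x : X) :
  exists2 f : dual X, (forall y, `|sval f y| <= `|y|) & sval f x = `|x|.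
Proof.
have ns : sublinear (fun y : X => `|y|).
  by split=> [y z|s y s0]; [exact: ler_normD | rewrite normrZ ger0_norm].
have [f fle fx] := hahn_banach x ns.
have fb y : `|f y| <= 1 * `|y|.
  by rewrite mul1r ler_norml fle andbT lerNl -linearN -[`|y|]normrN; exact: fle.
have [g gf] := dual_of_bound fb.
by exists g => [y|]; rewrite gf //; have := fb y; rewrite mul1r.
Qed.

(** Hahn-Banach for the sublinear functional [fun y => `|pos y|]. *)
Lemma positive_norming_functional (E : banachLatticeType R) (x : E) :
  0 <=E x -> exists f : dual E, [/\ forall y, 0 <=E y -> 0 <= sval f y :> R,
    forall y, `|sval f y| <= `|y| & sval f x = `|x|].
Proof.
move=> x0.
have ns : sublinear (fun y : E => `|pos y|).
  split=> [y z|s y s0]; last by rewrite pos_scale // normrZ ger0_norm.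
  by apply: le_trans (ler_normD _ _); apply: lev_norm (posD _ _); exact: pos_ge0.
have [f fle fx] := hahn_banach x ns.
have fb y : `|f y| <= 1 * `|y|.
  rewrite mul1r ler_norml (le_trans (fle y) (norm_pos y)) andbT lerNl -linearN.
  by rewrite -[`|y|]normrN; exact: le_trans (fle _) (norm_pos _).
have [g gf] := dual_of_bound fb.
exists g; split=> [y y0|y|]; rewrite gf; last by rewrite fx pos_id.
  have := fle (- y); rewrite linearN /=.
  have -> : pos (- y) = 0.
    apply: bl_le_anti; last exact: pos_ge0.
    by apply: pos_le (bl_lexx _); have := levN y0; rewrite oppr0.
  by rewrite normr0 oppr_le0.
by have := fb y; rewrite mul1r.
Qed.

End norming_functionals.

(** * Weakly compact sets *)

Section weak_topology.
Context (R : realType).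

Lemma weak_continuous (X : normedModType R) (f : dual X) :
  continuous (sval f : weak_space X -> R^o).
Proof.
move=> x U /(@initial_continuous X R^o (sval f) x) Uf.
have : (nbhs (x : weak_space X) : set_system X) --> (x : weak_space X).
  exact: cvg_id.
by move=> /cvg_sup h; exact: (h (@nbhs_filter (weak_space X) x) f _ Uf).
Qed.

Lemma weak_cvg (X : normedModType R) (F : set_system X) (x : X) :
  Filter F -> (forall f : dual X, sval f @ F --> (sval f x : R^o)) ->
  F --> (x : weak_space X).
Proof.
move=> FF Fx; apply/cvg_sup => f U.
have /= -> := @nbhsE (initial_topology (sval f : X -> R^o)) x.
case=> B [[C oC <-] Cx] /filterS; apply; apply: (Fx f).
exact: open_nbhs_nbhs.
Qed.

(** Functionals separate points, by Hahn-Banach. *)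
Lemma weak_hausdorff (X : normedModType R) : hausdorff_space (weak_space X).
Proof.
move=> x y xy; have [f _ fxy] := norming_functional (x - y : X).
suff : sval f x = sval f y.
  move=> /eqP; rewrite -subr_eq0 -linearB fxy normr_eq0 subr_eq0.
  by move/eqP.
apply: (@norm_hausdorff R R^o) => A B /weak_continuous fA /weak_continuous fB.
have [z [Az Bz]] := xy _ _ fA fB.
by exists (sval f z).
Qed.

(** The form in which weak compactness is exploited: a sequence clusters
    simultaneously for any finite number of functionals. *)
Lemma weakly_compact_cluster (X : normedModType R) (W : set X) (x : nat -> X) :
  relatively_weakly_compact W -> (forall n, W (x n)) ->
  exists y, forall (f : nat -> dual X) (p : nat) (e : R) (N : nat), 0 < e ->
    exists2 n, (N <= n)%N &
      forall i, (i < p)%N -> `|sval (f i) (x n) - sval (f i) y| < e.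
Proof.
move=> [K WK [cK _]] Wx.
have [|y [_ xy]] := cK (x @ \oo : set_system (weak_space X)).
  by exists 0%N => // n _; exact: WK.
exists y => f p e N e0.
have yU : \forall z \near (y : weak_space X),
    forall i : 'I_p, `|sval (f i) z - sval (f i) y| < e.
  have yF := @nbhs_filter (weak_space X) y.
  apply: (@filter_forall _ _ (fun (i : 'I_p) z => `|sval (f i) z - sval (f i) y| < e)
    _ yF) => i.
  have /cvgrPdist_lt/(_ e e0) := @weak_continuous X (f i) y.
  by apply: filterS => z; rewrite distrC.
have xN : (x @ \oo : set_system (weak_space X)) (x @` [set n | (N <= n)%N]).
  by exists N => // n Nn; exists n.
have [_ [[n Nn <-] xnU]] := xy _ _ xN yU.
by exists n => // i ip; exact: (xnU (Ordinal ip)).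
Qed.

Lemma dual_bounded (X : normedModType R) (f : dual X) :
  exists2 D, 0 <= D & forall y, `|sval f y| <= D * `|y|.
Proof.
have /linear_boundedP := @continuous_linear_bounded _ _ _ 0 (sval f) (svalP f 0).
by move=> /pinfty_ex_gt0[D D0 hD]; exists D; [exact: ltW | exact: hD].
Qed.

Lemma dual_comp (X Y : normedModType R) (T : {linear X -> Y}) (C : R) (f : dual Y) :
  (forall x, `|T x| <= C * `|x|) ->
  exists g : dual X, forall x, sval g x = sval f (T x).
Proof.
move=> TC; have [D D0 fD] := dual_bounded f.
have fTD z : `|(sval f \o T) z| <= D * C * `|z|.
  by rewrite -mulrA; apply: (le_trans (fD _)); rewrite ler_wpM2l.
by have [g gE] := dual_of_bound fTD; exists g.
Qed.

Lemma weakly_compact_image (X Y : normedModType R) (T : {linear X -> Y}) (C : R)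
    (W : set X) :
  (forall x, `|T x| <= C * `|x|) -> relatively_weakly_compact W ->
  relatively_weakly_compact (T @` W).
Proof.
move=> TC [K WK [cK _]].
apply: (@precompact_subset _ _ (T @` K : set (weak_space Y))).
  exact: image_subset.
apply: compact_precompact; first exact: weak_hausdorff.
apply: (@continuous_compact (weak_space X) (weak_space Y)) => //.
apply: continuous_subspaceT => x.
have xF := @nbhs_filter (weak_space X) x.
apply: (@weak_cvg Y _ (T x) (fmap_filter T xF)) => f.
have [g gE] := dual_comp f TC.
have gTE : (sval g : X -> R^o) = sval f \o T by apply/funext.
by have := @weak_continuous X g x; rewrite gTE.
Qed.

(** A weakly convergent sequence together with its limit is compact. *)
Lemma weakly_cvg_compact (X : normedModType R) (v : nat -> X) (z : X) :
  (forall f : dual X, (fun n => sval f (v n)) @ \oo --> (sval f z : R^o)) ->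
  relatively_weakly_compact (range v).
Proof.
move=> vz; have {}vz : v @ \oo --> (z : weak_space X).
  by apply: weak_cvg => f; exact: vz.
apply: (@precompact_subset _ _ (range v `|` [set z] : set (weak_space X))).
  exact: subsetUl.
apply: compact_precompact; first exact: weak_hausdorff.
move=> F FF Fv; have [zF|/existsNP[A /existsNP[B]]] := pselect (cluster F z).
  by exists z; split=> //; right.
move=> /not_implyP[FA] /not_implyP[zB AB0].
have [N _ NB] := vz _ zB.
have cL : compact (v @` [set n | (n < N)%N] : set (weak_space X)).
  by apply/finite_compact/finite_image; exact: finite_II.
have [|y [[n _ <-] yF]] := cL F FF; last first.
  by exists (v n); split => //; left; exists n.
(* [F] avoids the neighbourhood [B] of [z], so it lives on finitely many terms. *)
apply: filterS (filterI FA Fv) => y [Ay].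
have nBy : ~ B y by move=> By; apply: AB0; exists y.
move=> [[n _ ny]|yz]; last by case: nBy; rewrite yz; exact: (nbhs_singleton zB).
exists n => //=; rewrite ltnNge; apply/negP => Nn; apply: nBy.
by rewrite -ny; exact: NB.
Qed.

Lemma weakly_compact_set1 (X : normedModType R) (x : X) :
  relatively_weakly_compact [set x].
Proof.
apply: (@precompact_subset _ _ (range (fun _ : nat => x) : set (weak_space X))).
  by move=> _ ->; exists 0%N.
by apply: (@weakly_cvg_compact _ _ x) => f; exact: cvg_cst.
Qed.

Lemma sum_functionals (X : normedModType R) (g : nat -> {linear X -> R^o}) (C : R) :
  (forall n x, \sum_(k < n) `|g k x| <= C * `|x|) ->
  exists2 phi : dual X, (forall x, `|sval phi x| <= C * `|x|) &
    forall x, (fun n => \sum_(k < n) g k x) @ \oo --> (sval phi x : R^o).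
Proof.
move=> gC.
have gcvg x : cvgn (fun n => \sum_(k < n) g k x : R^o).
  have -> : (fun n => \sum_(k < n) g k x : R^o) = series (fun k => g k x : R^o).
    by apply/funext => n; rewrite /series /= big_mkord.
  apply: normed_cvg; apply: nondecreasing_is_cvgn.
    by apply: nondecreasing_series => n _ _; exact: normr_ge0.
  exists (C * `|x|) => _ [n _ <-]; rewrite /normed_series_of seriesEord /=.
  exact: gC.
pose f x : R^o := limn (fun n => \sum_(k < n) g k x : R^o).
have fE x : (fun n => \sum_(k < n) g k x : R^o) @ \oo --> f x by exact: gcvg.
have fl : linear f.
  move=> s x y; apply: (@cvg_lim R^o) => //.
  have -> : (fun n => \sum_(k < n) g k (s *: x + y) : R^o) =
      (fun n => s *: (\sum_(k < n) g k x : R^o) + (\sum_(k < n) g k y : R^o)).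
    apply/funext => n; rewrite scaler_sumr -big_split /=; apply: eq_bigr => k _.
    by rewrite linearP.
  by apply: cvgD => //; exact: cvgZr.
pose F : {linear X -> R^o} := HB.pack f (GRing.isLinear.Build _ _ _ _ f fl).
have FC x : `|F x| <= C * `|x|.
  have nf : (fun n => `|\sum_(k < n) g k x : R^o|) @ \oo --> `|f x|.
    by apply: cvg_norm; exact: fE.
  apply: (cvgr_to_le nf).
  by near=> n; apply: (le_trans (ler_norm_sum _ _ _)); exact: gC.
have [phi phiE] := dual_of_bound FC.
by exists phi => x; rewrite phiE //; exact: fE.
Unshelve. all: by end_near. Qed.

Lemma geometric_sum_le (a : R) (n : nat) : 0 <= a -> a < 1 ->
  \sum_(k < n) a ^+ k <= (1 - a)^-1.
Proof.
move=> a0 a1; rewrite -[X in _ <= X]mul1r ler_pdivlMr ?subr_gt0 // mulrC.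
rewrite -opprB mulNr -subrX1 opprB gerBl; exact: exprn_ge0.
Qed.

End weak_topology.

(** * Gliding humps *)

Section subsequences.

Lemma dependent_subsequence (P : nat -> nat -> nat -> Prop) :
  (forall k m, exists2 m', (m < m')%N & P k m m') ->
  exists nu : nat -> nat,
    (forall k, (nu k < nu k.+1)%N) /\ forall k, P k (nu k) (nu k.+1).
Proof.
move=> h; have : forall km : nat * nat, exists m', (km.2 < m')%N /\ P km.1 km.2 m'.
  by move=> [k m]; have [m' ? ?] := h k m; exists m'.
move=> /choice[f fP].
pose nu := nat_rect (fun=> nat) 0%N (fun k m => f (k, m)).
by exists nu; split=> k; have [] := fP (k, nu k).
Qed.

Lemma subsequence_ge (nu : nat -> nat) : (forall k, (nu k < nu k.+1)%N) ->
  forall k, (k <= nu k)%N.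
Proof. by move=> h; elim=> // k ih; exact: leq_ltn_trans ih (h k). Qed.

Lemma subsequence_homo (nu : nat -> nat) : (forall k, (nu k < nu k.+1)%N) ->
  {homo nu : i j / (i < j)%N}.
Proof. by move=> h; apply: homo_ltn => //; exact: ltn_trans. Qed.

Lemma not_cvg0_subsequence (R : realType) (V : normedModType R) (u : nat -> V) :
  ~ (u @ \oo --> (0 : V)) -> exists2 e : R, 0 < e & exists nu : nat -> nat,
    (forall k, (nu k < nu k.+1)%N) /\ forall k, e <= `|u (nu k)|.
Proof.
move=> nu0.
have [e e0 he] : exists2 e : R, 0 < e &
    forall N, exists2 n, (N <= n)%N & e <= `|u n|.
  apply: contrapT => /forall2NP h; apply: nu0; apply/cvgr0Pnorm_lt => e e0.
  have [//|/existsNP[N /forall2NP hN]] := h e.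
  exists N => // n /= Nn; have [//|/negP] := hN n.
  by rewrite -ltNge.
exists e => //; have [|nu [nui nuP]] :=
    @dependent_subsequence (fun _ _ m' => e <= `|u m'|).
  by move=> _ m; have [n mn en] := he m.+1; exists n.
by exists (nu \o succn); split=> k /=.
Qed.

Lemma sum_subsequence_le (R : realType) (a : nat -> R) (nu : nat -> nat) (n : nat) :
  (forall k, 0 <= a k) -> (forall k, (nu k < nu k.+1)%N) ->
  \sum_(k < n) a (nu k) <= \sum_(nu 0%N <= j < nu n) a j.
Proof.
move=> a0 nui; elim: n => [|n ih]; first by rewrite big_ord0 big_geq.
have nu0n : (nu 0%N <= nu n)%N.
  by elim: (n) => // k /leq_trans; apply; exact: ltnW.
rewrite big_ord_recr /= (big_cat_nat nu0n (ltnW (nui n))) /= lerD //.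
rewrite big_ltn // lerDl; exact: sumr_ge0.
Qed.

Lemma sum_subsequence_bound (R : realType) (a : nat -> R) (nu : nat -> nat)
    (B : R) : (forall k, 0 <= a k) -> (forall k, (nu k < nu k.+1)%N) ->
  (forall n, \sum_(k < n) a k <= B) -> forall n, \sum_(k < n) a (nu k) <= B.
Proof.
move=> a0 nui aB n; apply: (le_trans (sum_subsequence_le n a0 nui)).
rewrite (le_trans _ (aB (nu n))) // -(big_mkord xpredT a).
rewrite (big_cat_nat (leq0n (nu 0%N))) /= ?lerDr ?sumr_ge0 //.
by elim: (n) => // k /leq_trans; apply; exact: ltnW.
Qed.

Lemma bounded_sum_tail (R : realType) (a : nat -> R) (B e : R) :
  (forall k, 0 <= a k) -> (forall n, \sum_(k < n) a k <= B) -> 0 < e ->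
  exists N, forall m n, (N <= m)%N -> \sum_(m <= k < n) a k <= e.
Proof.
move=> a0 aB e0; pose S := range (fun n => \sum_(k < n) a k).
have S_sup : has_sup S.
  split; first by exists (\sum_(k < 0) a k); exists 0%N.
  by exists B => _ [n _ <-].
have [_ [N _ <-] hN] := sup_adherent e0 S_sup.
exists N => m n Nm; have [mn|nm] := leqP m n; last by rewrite big_geq ?ltW // ltnW.
have : \sum_(k < n) a k <= sup S by apply: sup_upper_bound => //; exists n.
rewrite -(big_mkord xpredT a) (big_cat_nat (leq0n m) mn) /=.
rewrite (big_cat_nat (leq0n N) Nm) /= big_mkord => h.
have h1 : 0 <= \sum_(N <= i < m) a i by exact: sumr_ge0.
by move: hN h h1; lra.
Qed.

End subsequences.

Section gliding_humps.
Context (R : realType) (X : normedModType R).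

(** If [x n] had norms growing faster than [3 ^ n] in a weakly compact set, a
    series of functionals norming the [x n], with weights [3 ^ - n] and signs
    chosen so that no term cancels the previous partial sum, would be unbounded
    along [x n]. *)
Lemma weakly_compact_bounded (W : set X) :
  relatively_weakly_compact W -> exists M : R, forall x, W x -> `|x| <= M.
Proof.
move=> cW; apply: contrapT => /forallNP nM.
have : forall n : nat, exists x, W x /\ n%:R * 3 ^+ n <= `|x| :> R.
  move=> n; have /existsNP[x /not_implyP[Wx /negP]] := nM (n%:R * 3 ^+ n).
  by rewrite -ltNge => /ltW h; exists x.
move=> /choice[x xP].
have : forall n, exists f : dual X, (forall y, `|sval f y| <= `|y|) /\
    sval f (x n) = `|x n|.
  by move=> n; have [f fb fx] := norming_functional (x n); exists f.
move=> /choice[f fP].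
pose S := nat_rect (fun=> X -> R) (fun=> 0) (fun k Sk z =>
  Sk z + (if 0 <= Sk (x k) then 1 else -1) * 3^-1 ^+ k * sval (f k) z).
pose s k : R := if 0 <= S k (x k) then 1 else -1.
pose g k : {linear X -> R^o} := (s k * 3^-1 ^+ k) \*: sval (f k).
have sE k : `|s k| = 1 by rewrite /s; case: ifP; rewrite ?normrN normr1.
have SE n z : S n z = \sum_(k < n) g k z.
  by elim: n => [|n ih]; rewrite ?big_ord0 // big_ord_recr /= -ih.
have i30 : 0 <= 3^-1 :> R by lra.
have gle k z : `|g k z| <= 3^-1 ^+ k * `|z|.
  rewrite /= normrZ normrM sE mul1r ger0_norm ?exprn_ge0 //.
  by rewrite ler_wpM2l ?exprn_ge0 //; exact: (fP k).1.
have gsum n z : \sum_(k < n) `|g k z| <= (1 - 3^-1)^-1 * `|z|.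
  apply: (@le_trans _ _ (\sum_(k < n) 3^-1 ^+ k * `|z|)).
    by apply: ler_sum => k _; exact: gle.
  by rewrite -mulr_suml ler_wpM2r // geometric_sum_le //; lra.
have inv : (1 - 3^-1)^-1 = 3 / 2 :> R.
  by rewrite -invf_div; congr _^-1; lra.
have [phi _ phiE] := sum_functionals gsum.
have Sx k : 3^-1 ^+ k * `|x k| <= `|S k.+1 (x k)|.
  rewrite /= (fP k).2; set t := 3^-1 ^+ k * _.
  have t0 : 0 <= t by rewrite mulr_ge0 // exprn_ge0.
  rewrite -mulrA -/t; have [S0|S0] := lerP 0 (S k (x k)).
    by rewrite mul1r ger0_norm ?addr_ge0 // lerDr.
  by rewrite mulN1r ler0_norm ?opprD ?opprK; move: S0 t0; lra.
have tail k z : `|sval phi z - S k.+1 z| <= 2^-1 * 3^-1 ^+ k * `|z|.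
  have h : (fun n => `|\sum_(j < n) g j z - S k.+1 z : R^o|) @ \oo -->
      `|sval phi z - S k.+1 z : R^o|.
    by apply: cvg_norm; apply: cvgB (phiE z) (cvg_cst _).
  apply: (cvgr_to_le h); exists k.+1 => // n /= kn.
  move: (n - k.+1)%N (subnKC kn) => m <-.
  have -> : \sum_(j < k.+1 + m) g j z - S k.+1 z = \sum_(j < m) g (k.+1 + j)%N z.
    by rewrite SE big_split_ord addrAC subrr add0r.
  apply: (le_trans (ler_norm_sum _ _ _)).
  apply: (@le_trans _ _ (\sum_(j < m) 3^-1 ^+ j * (3^-1 ^+ k.+1 * `|z|))).
    by apply: ler_sum => j _; rewrite mulrA -exprD addnC; exact: gle.
  rewrite -mulr_suml.
  apply: (@le_trans _ _ ((1 - 3^-1)^-1 * (3^-1 ^+ k.+1 * `|z|))).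
    rewrite ler_wpM2r ?mulr_ge0 ?exprn_ge0 // geometric_sum_le //; lra.
  by rewrite exprS !mulrA ler_wpM2r // ler_wpM2r ?exprn_ge0 // inv; lra.
have phix k : k%:R / 2 <= `|sval phi (x k)|.
  have h1 := Sx k; have h2 := tail k (x k).
  have h3 : k%:R <= 3^-1 ^+ k * `|x k|.
    rewrite exprVn mulrC ler_pdivlMr ?exprn_gt0 //; exact: (xP k).2.
  have := ler_normB (sval phi (x k)) (sval phi (x k) - S k.+1 (x k)).
  rewrite opprB addrC subrK => h4; move: h1 h2 h3 h4; rewrite -mulrA.
  by set a := 3^-1 ^+ k * _; lra.
(* By compactness [phi] is bounded on infinitely many of the [x n]. *)
have [y yP] := weakly_compact_cluster cW (fun n => (xP n).1).
have [n hn /(_ 0%N isT) xn] :=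
  yP (fun=> phi) 1%N 1 (Num.truncn (2 * (`|sval phi y| + 1))).+1 ltr01.
have := lerB_dist (sval phi (x n)) (sval phi y).
have := truncnS_gt (2 * (`|sval phi y| + 1)).
have : (Num.truncn (2 * (`|sval phi y| + 1))).+1%:R <= n%:R :> R.
  by rewrite ler_nat.
have := phix n; move: xn; lra.
Qed.

(** The Schur property of the sequence space [l1], applied to the operator
    [fun z => (h n z)_n]. A gliding hump along [x n - y], for a cluster point [y]
    of [x], yields a subsequence and a sum [phi] of some of the [h n] that stays
    away from [phi y] along that subsequence. As the [h n] converge along the
    subsequence, its own cluster points agree with [y] for every [h n], hence
    for [phi], which is absurd. *)
Lemma weakly_compact_diagonal (h : nat -> dual X) (C : R) (W : set X)
    (x : nat -> X) :
  (forall n z, \sum_(k < n) `|sval (h k) z| <= C * `|z|) ->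
  relatively_weakly_compact W -> (forall n, W (x n)) ->
  (fun n => sval (h n) (x n)) @ \oo --> (0 : R^o).
Proof.
move=> hC cW Wx; apply: contrapT => /not_cvg0_subsequence[e e0 [nu [nui nue]]].
wlog he : h x hC Wx nu nui nue / forall n, e <= `|sval (h n) (x n) : R^o|.
  move=> wl; apply: (wl (h \o nu) (x \o nu) _ _ id) => //.
  - move=> n z; apply: (sum_subsequence_bound (a := fun k => `|sval (h k) z|)) => //.
  - by move=> n; exact: Wx.
move=> {nu nui nue}.
have [y yP] := weakly_compact_cluster cW Wx.
pose d := e / 8; have d0 : 0 < d by rewrite /d divr_gt0.
have small z : exists N, forall m n, (N <= m)%N ->
    \sum_(m <= k < n) `|sval (h k) z : R| <= d.
  exact: (bounded_sum_tail _ (hC ^~ z)).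
have [Ny hNy] := small y.
(* If [m] carries the [k]-th hump, [m'] can carry the next one: the functionals
   up to [m] are small on [x m' - y], those from [m'] on are small on [x m - y]. *)
pose P k m m' := [/\ forall j, (j <= m)%N ->
    `|sval (h j) (x m') - sval (h j) y : R| < d / (m.+1 * k.+1)%:R,
    forall n, \sum_(m' <= j < n) `|sval (h j) (x m - y) : R| <= d &
    `|sval (h m') y : R| <= d].
have [nu [nui nuP]] : exists nu : nat -> nat,
    (forall k, (nu k < nu k.+1)%N) /\ forall k, P k (nu k) (nu k.+1).
  apply: dependent_subsequence => k m; have [N hN] := small (x m - y).
  have [|m' m'N hm'] := yP h m.+1 (d / (m.+1 * k.+1)%:R) (maxn m.+1 (maxn N Ny)).
    by rewrite divr_gt0 // ltr0n.
  move: m'N; rewrite !geq_max => /and3P[mm' Nm' Nym'].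
  exists m' => //; split => //; first by move=> n; exact: hN.
  by have := hNy m' m'.+1 Nym'; rewrite big_nat1.
have nuk := subsequence_ge nui.
have nu_le := leq_mono (subsequence_homo nui).
have [|phi _ phiE] := @sum_functionals _ _ (fun k => sval (h (nu k))) C.
  move=> n z; apply: (sum_subsequence_bound (a := fun k => `|sval (h k) z|)) => //.
have hump k : 5 * d <= `|sval phi (x (nu k.+1)) - sval phi y|.
  rewrite -linearB /=; set z := x (nu k.+1) - y.
  have [head _ hy] := nuP k; have [_ tail _] := nuP k.+1.
  have zphi : (fun n => `|\sum_(i < n) sval (h (nu i)) z : R^o|) @ \oo -->
    `|sval phi z : R^o| by apply: cvg_norm; exact: phiE.
  apply: (cvgr_to_ge zphi); exists k.+2 => // n /= kn.
  move: (n - k.+2)%N (subnKC kn) => m <- {n kn}.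
  rewrite big_split_ord big_ord_recr /=.
  set A := \sum_(i < k.+1) _; set B := \sum_(i < m) _.
  have Ad : `|A| <= d.
    apply: (le_trans (ler_norm_sum _ _ _)).
    apply: (@le_trans _ _ (\sum_(i < k.+1) d / ((nu k).+1 * k.+1)%:R)).
      apply: ler_sum => i _; rewrite linearB; apply: ltW; apply: head.
      by rewrite nu_le -ltnS.
    rewrite sumr_const card_ord natrM invfM mulrA -[_ *+ _]mulr_natr mulfVK //.
    by rewrite ler_piMr ?invf_le1 ?ltr0n ?ler1n // ltW.
  have Bd : `|B| <= d.
    apply: (le_trans (ler_norm_sum _ _ _)).
    have := @sum_subsequence_le R (fun j => `|sval (h j) z|)
      (fun i => nu (k.+2 + i)%N) m (fun=> normr_ge0 _).
    move=> /(_ _)/le_trans; apply; last by rewrite addn0; exact: tail.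
    by move=> i; rewrite addnS.
  have Ce : e - d <= `|sval (h (nu k.+1)) z|.
    rewrite linearB; apply: le_trans (lerB_dist _ _).
    by apply: lerB; [exact: he | exact: hy].
  have ed : e = 8 * d by rewrite /d mulrC divfK.
  have h1 := lerB_dist (sval (h (nu k.+1)) z) (- (A + B)).
  have h2 := ler_normD A B.
  rewrite normrN opprK [_ + (A + B)]addrC addrAC in h1.
  by move: Ad Bd Ce h1 h2; rewrite ed; lra.
have [y' y'P] := weakly_compact_cluster cW (fun k => Wx (nu k.+1)).
(* Only [h 0 .. h m] are controlled at the step leaving [m], but any [h j] is
   eventually among them. *)
have hy' j : sval (h j) y' = sval (h j) y.
  apply/eqP; rewrite -subr_eq0 -normr_le0; apply/ler_addgt0Pl => r r0.
  rewrite addr0.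
  have [|n nN /(_ j (ltnSn j)) h1] :=
      y'P h j.+1 (r / 2) (maxn j (Num.truncn (2 * d / r)).+1).
    by rewrite divr_gt0.
  move: nN; rewrite geq_max => /andP[jn nr].
  have [/(_ j (leq_trans jn (nuk n))) h2 _ _] := nuP n.
  have h3 : d / ((nu n).+1 * n.+1)%:R <= r / 2.
    rewrite ler_pdivrMr ?ltr0n //.
    have h4 : 2 * d / r <= ((nu n).+1 * n.+1)%:R.
      apply: (le_trans (ltW (truncnS_gt _))); rewrite ler_nat.
      by rewrite (leq_trans nr) // (leq_trans (leqnSn n)) // leq_pmull.
    by move: h4; rewrite ler_pdivrMr //; lra.
  apply: (le_trans (ler_distD (sval (h j) (x (nu n.+1))) _ _)).
  rewrite [`|sval (h j) y' - _|]distrC [r]splitr.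
  by apply: lerD; apply: ltW; [exact: h1 | exact: lt_le_trans h2 h3].
have phiy' : sval phi y' = sval phi y.
  have := phiE y'; under eq_fun do under eq_bigr do rewrite hy'.
  by move=> h1; exact: (cvg_unique _ h1 (phiE y)).
have [n _ /(_ 0%N isT)] := y'P (fun=> phi) 1%N d 0%N d0.
by rewrite phiy' => hn; have := hump n; move: hn d0; lra.
Qed.

End gliding_humps.

(** * Positive operators and disjoint sequences *)

Section positive_operators.
Context (R : realType) (E : banachLatticeType R).

Lemma positive_mono (T : {linear E -> E}) x y : positive_op T -> x <=E y ->
  T x <=E T y.
Proof. by move=> T0 /levBr xy; apply/levBr; rewrite -linearB; exact: T0. Qed.

Lemma positive_modulus (T : {linear E -> E}) x : positive_op T ->
  modulus (T x) <=E T (modulus x).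
Proof.
move=> T0; apply: modulus_le; first exact: positive_mono (lev_modulus x).
by rewrite -linearN; exact: positive_mono (levN_modulus x).
Qed.

Lemma half_exp_gt0 n : 0 < 2^-1 ^+ n :> R.
Proof. by rewrite exprn_gt0 // invr_gt0. Qed.

Lemma half_exp_cvg0 (a : R) : (fun n => 2^-1 ^+ n * a) @ \oo --> (0 : R).
Proof.
rewrite -[X in _ --> X](mul0r a); apply: cvgM; last exact: cvg_cst.
by apply: cvg_expr; rewrite ger0_norm; lra.
Qed.

(** The sum of an absolutely convergent positive series dominates its terms. *)
Lemma positive_series_ub (y : nat -> E) (M : R) :
  (forall n, 0 <=E y n) -> (forall n, `|y n| <= 2^-1 ^+ n * M) ->
  exists2 w, 0 <=E w & forall n, y n <=E w.
Proof.
move=> y0 yM.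
have M0 : 0 <= M by have := yM 0%N; rewrite mul1r; exact: le_trans.
have cy : cvgn (series y).
  apply: normed_cvg; apply: nondecreasing_is_cvgn.
    by apply: nondecreasing_series => n _ _; exact: normr_ge0.
  exists ((1 - 2^-1)^-1 * M) => _ [n _ <-]; rewrite /normed_series_of seriesEord /=.
  apply: (@le_trans _ _ (\sum_(k < n) 2^-1 ^+ k * M)).
    by apply: ler_sum => k _; exact: yM.
  by rewrite -mulr_suml ler_wpM2r // geometric_sum_le //; lra.
have le_lim n : y n <=E limn (series y).
  apply: (@lev_cvg _ _ (fun=> y n) (fun m => series y (m + n.+1)%N)).
  - exact: cvg_cst.
  - by rewrite (cvg_shiftn n.+1 (series y)).
  - move=> m; rewrite seriesEord /= addnC big_split_ord big_ord_recr /=.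
    rewrite addrAC; apply: levDr; apply: addv_ge0; exact: sumv_ge0.
by exists (limn (series y)) => //; exact: lev_trans (y0 0%N) (le_lim 0%N).
Qed.

(** Otherwise some summable series of positive vectors [y n] has [T (y n)]
    unbounded, although each [T (y n)] is below the image of the sum. *)
Lemma positive_bounded (T : {linear E -> E}) : positive_op T ->
  exists2 C : R, 0 <= C & forall x, `|T x| <= C * `|x|.
Proof.
move=> T0; apply: contrapT => /forall2NP nb.
have : forall n, exists y, [/\ 0 <=E y, `|y| <= 2^-1 ^+ n * 1 & n%:R <= `|T y| :> R].
  move=> n; have [/negP|/existsNP[x /negP]] := nb (2 ^+ n * n%:R).
    by rewrite mulr_ge0 // exprn_ge0.
  rewrite -ltNge => Tx.
  have x0 : 0 < `|x|.
    by rewrite lt_def normr_ge0 andbT; apply: contraTneq Tx => /normr0_eq0 ->;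
      rewrite linear0 normr0 mulr0 ltxx.
  exists ((2^-1 ^+ n / `|x|) *: modulus x).
  have c0 : 0 < 2^-1 ^+ n / `|x| by rewrite divr_gt0 // half_exp_gt0.
  split.
  - by apply: bl_scale_ge0 (modulus_ge0 _); exact: ltW.
  - by rewrite normrZ norm_modulus gtr0_norm // divfK ?gt_eqF // mulr1.
  - rewrite linearZ normrZ gtr0_norm // mulrAC ler_pdivlMr //.
    rewrite exprVn ler_pdivlMl ?exprn_gt0 // mulrA; apply: (le_trans (ltW Tx)).
    exact: lev_modulus_norm (positive_modulus _ T0).
move=> /choice[y yP].
have [w w0 yw] := positive_series_ub (fun n => (let: And3 a _ _ := yP n in a))
  (fun n => (let: And3 _ b _ := yP n in b)).
have := truncnS_gt `|T w|; apply/negP; rewrite -leNgt.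
set n := (Num.truncn _).+1; have [yn0 _] := yP n; move=> /le_trans; apply.
by apply: lev_norm; [exact: T0 | exact: positive_mono].
Qed.

(** For a functional [f] let [h n] be the positive part of [f] on the ideal
    generated by [v n]. Disjointness makes the [h n] summable, so that they
    vanish along the weakly compact sequence [x], and [f (v n) <= h n (x n)]. *)
Lemma disjoint_weakly_null (W : set E) (x v : nat -> E) (f : dual E) :
  relatively_weakly_compact W -> (forall n, W (x n)) ->
  (forall n, 0 <=E v n) -> (forall n, v n <=E pos (x n)) ->
  (forall i j, i <> j -> bl_meet (v i) (v j) = 0) ->
  (fun n => sval f (v n)) @ \oo --> (0 : R^o).
Proof.
move=> cW Wx v0 vx dv.
have upper (g : {linear E -> R^o}) (C : R) :
    0 <= C -> (forall z, `|g z| <= C * `|z|) ->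
    exists2 b : nat -> R^o, b @ \oo --> (0 : R^o) & forall n, g (v n) <= b n :> R.
  move=> C0 gC.
  pose I n := [set y : E | exists2 s : R, 0 <= s & y <=E s *: v n].
  have I_ideal n : cone_ideal (I n).
    split.
    - by exists 0 => //; rewrite scale0r; exact: bl_lexx.
    - move=> y z [s s0 ys] [t t0 zt]; exists (s + t); first exact: addr_ge0.
      by rewrite scalerDl; exact: levD.
    - move=> s y s0 [t t0 yt]; exists (s * t); first exact: mulr_ge0.
      by rewrite -scalerA; exact: lev_wscale.
    - by move=> y z _ yz [t t0 zt]; exists t => //; exact: lev_trans yz zt.
  have gle y z : 0 <=E y -> y <=E z -> g y <= C * `|z| :> R.
    move=> y0 yz; apply: (le_trans (ler_norm _)); apply: (le_trans (gC y)).
    by rewrite ler_wpM2l // lev_norm.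
  have : forall n, exists h : {linear E -> R^o}, forall z, 0 <=E z ->
      (forall y, 0 <=E y -> y <=E z -> I n y -> g y <= h z :> R) /\
      (forall u : R, (forall y, 0 <=E y -> y <=E z -> I n y -> g y <= u :> R) ->
        h z <= u :> R).
    move=> n; apply: (@riesz_kantorovich R E R^o g) => //.
      exact: real_dedekind_complete.
    by move=> z z0; exists (C * `|z|) => y y0 yz _; exact: gle.
  move=> /choice[h hP].
  have h_ge0 n z : 0 <=E z -> 0 <= h n z :> R.
    move=> z0; rewrite -(linear0 g); apply: (hP n z z0).1 => //.
    - exact: bl_lexx.
    - by have [] := I_ideal n.
  (* Vectors below [z] in distinct ideals are disjoint, so their sum is below [z]. *)
  have h_sum n z : 0 <=E z -> \sum_(k < n) h k z <= C * `|z| :> R.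
    move=> z0; apply/ler_addgt0Pl => e e0.
    pose d := e / n.+1%:R.
    have d0 : 0 < d by rewrite divr_gt0.
    have : forall k, exists y, [/\ 0 <=E y, y <=E z, I k y & h k z - d <= g y :> R].
      move=> k; apply: contrapT => /forallNP ny.
      have : h k z <= h k z - d.
        apply: (hP k z z0).2 => y y0 yz Iy; rewrite leNgt; apply/negP => lt.
        by apply: (ny y); split=> //; exact: ltW.
      by rewrite lerBrDr gerDl leNgt d0.
    move=> /choice[y yP].
    have yd i j : i <> j -> bl_meet (y i) (y j) = 0.
      move=> ij; have [yi0 _ [s s0 yis] _] := yP i.
      have [yj0 _ [t t0 yjt] _] := yP j.
      apply: (disjoint_le yi0 yis yj0 yjt); apply: disjoint_scale => //.
      exact: dv.
    have ysum : \sum_(k < n) y k <=E z.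
      by apply: disjoint_sum_le => // k; have [] := yP k.
    apply: (@le_trans _ _ (\sum_(k < n) (g (y k) + d))).
      by apply: ler_sum => k _; rewrite -lerBlDr; have [] := yP k.
    rewrite big_split /= sumr_const card_ord addrC; apply: lerD.
      rewrite -[d *+ n]mulr_natr /d mulrAC ler_pdivrMr // ler_pM2l //.
      by rewrite ler_nat.
    rewrite -(linear_sum g); apply: gle => //.
    by apply: sumv_ge0 => k _; have [] := yP k.
  have h_mod n z : `|h n z| <= h n (modulus z) :> R.
    rewrite modulusE -{1}(posBpos z) linearB linearD.
    apply: (le_trans (ler_normB _ _)).
    by rewrite !ger0_norm //; apply: h_ge0; exact: pos_ge0.
  have h_abs n z : \sum_(k < n) `|h k z| <= C * `|z| :> R.
    apply: (@le_trans _ _ (\sum_(k < n) h k (modulus z))).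
      by apply: ler_sum => k _; exact: h_mod.
    by rewrite -[`|z|]norm_modulus; apply: h_sum; exact: modulus_ge0.
  have : forall n, exists h' : dual E, forall z, sval h' z = h n z.
    move=> n; have [|h' h'E] := @dual_of_bound R E (h n) C; last by exists h'.
    move=> z; apply: (le_trans _ (h_abs n.+1 z)).
    by rewrite big_ord_recr /= lerDr sumr_ge0.
  move=> /choice[h' h'E].
  exists (fun n => sval (h' n) (x n)).
    apply: (weakly_compact_diagonal (C := C) _ cW Wx) => n z.
    by under eq_bigr do rewrite h'E; exact: h_abs.
  move=> n; rewrite h'E -(posBpos (x n)) linearB /=.
  (* [v n] is disjoint from the negative part of [x n]. *)
  have hneg : h n (pos (- x n)) <= 0 :> R.
    apply: (hP n _ (pos_ge0 _)).2 => y y0 yx [s s0 ys].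
    suff -> : y = 0 by rewrite linear0.
    apply: bl_le_anti => //.
    rewrite -(@disjoint_scale _ _ (pos (x n)) (pos (- x n)) s 1) //.
    + rewrite scale1r; apply: lev_meet => //; apply: (lev_trans ys).
      exact: lev_wscale.
    + exact: pos_ge0.
    + exact: pos_ge0.
    + exact: meet_pos_neg.
  have gh : g (v n) <= h n (pos (x n)) :> R.
    apply: (hP n _ (pos_ge0 _)).1 => //.
    by exists 1 => //; rewrite scale1r; exact: bl_lexx.
  by rewrite lerBrDr; apply: le_trans gh; rewrite gerDl.
have [C C0 fC] := dual_bounded f.
have [b b0 fb] := upper (sval f) C C0 fC.
have [|c c0 fc] := upper (\- sval f) C C0.
  by move=> z; rewrite /= normrN; exact: fC.
apply: (@squeeze_cvgr _ _ _ _ (fun n => - c n) b) => //.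
  by near=> n; rewrite fb andbT lerNl; exact: fc.
by rewrite -[X in _ --> X]oppr0; exact: cvgN.
Unshelve. all: by end_near. Qed.

End positive_operators.

(** * Disjoint sequences in solid hulls *)

Section disjointification.
Context (R : realType) (E : banachLatticeType R).

(** If the conclusion fails, there are [l n] in [L] at distance more than [e]
    from [4 ^ n] times the sum of the moduli of their predecessors; the vectors
    [pos (l n - 4 ^ n * sum_(i < n) `|l i| - 2 ^- n * w)], where [w] dominates
    every [2 ^- m * `|l m|], are then disjoint. *)
Lemma approx_order_bounded (T : {linear E -> E}) (L : set E) (M e : R) :
  positive_op T -> (forall x, L x -> `|x| <= M) ->
  (forall v l : nat -> E, (forall n, L (l n)) -> (forall n, 0 <=E v n) ->
    (forall n, v n <=E pos (l n)) ->
    (forall i j, i <> j -> bl_meet (v i) (v j) = 0) ->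
    (fun n => T (v n)) @ \oo --> (0 : E)) ->
  0 < e ->
  exists s : seq E, (forall y, y \in s -> L y) /\
    forall x, L x ->
      `|T (pos (x - 4 ^+ size s *: \sum_(y <- s) modulus y))| <= e.
Proof.
move=> T0 LM Tnull e0; apply: contrapT => /forallNP nappr.
have : forall s : seq E, exists x, (forall y, y \in s -> L y) ->
    L x /\ e < `|T (pos (x - 4 ^+ size s *: \sum_(y <- s) modulus y))|.
  move=> s; have /not_andP[/existsNP[y /not_implyP[ys nLy]]|] := nappr s.
    by exists 0 => /(_ y ys).
  by move=> /existsNP[x /not_implyP[Lx /negP]]; rewrite -ltNge => ex; exists x.
move=> /choice[F FP].
pose st n := iter n (fun s => rcons s (F s)) [::].
pose l n := F (st n).
have stL n : forall y, y \in st n -> L y.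
  elim: n => // n ih y; rewrite /= mem_rcons inE => /orP[/eqP ->|]; last exact: ih.
  exact: (FP _ ih).1.
have lL n : L (l n) := (FP _ (stL n)).1.
have st_size n : size (st n) = n.
  by elim: n => // n ih; rewrite /= size_rcons ih.
pose U n := \sum_(i < n) modulus (l i).
have stU n : \sum_(y <- st n) modulus y = U n.
  elim: n => [|n ih]; first by rewrite /U big_nil big_ord0.
  by rewrite /= -cats1 big_cat big_seq1 ih /U big_ord_recr.
have le n : e < `|T (pos (l n - 4 ^+ n *: U n))|.
  by have := (FP _ (stL n)).2; rewrite st_size stU.
have U0 n : 0 <=E U n by apply: sumv_ge0 => i _; exact: modulus_ge0.
have p40 n : 0 <= 4 ^+ n :> R by rewrite exprn_ge0.
have h0 n := ltW (half_exp_gt0 R n).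
have [||w w0 lw] := @positive_series_ub _ _ (fun n => 2^-1 ^+ n *: modulus (l n)) M.
- by move=> n; exact: bl_scale_ge0 (modulus_ge0 _).
- move=> n; rewrite normrZ norm_modulus ger0_norm //.
  by rewrite ler_wpM2l //; exact: LM.
pose v n := pos (l n - 4 ^+ n *: U n - 2^-1 ^+ n *: w).
have v0 n : 0 <=E v n by exact: pos_ge0.
(* [v i] lives on the positive part of [a], [v j] on its negative part. *)
have vd i j : (i < j)%N -> bl_meet (v i) (v j) = 0.
  move=> ij; pose a := l i - 4^-1 ^+ j *: l j.
  have q0 : 0 <= 4^-1 ^+ j :> R by rewrite exprn_ge0 // invr_ge0.
  have via : v i <=E pos a.
    apply: pos_mono; rewrite -addrA -opprD; apply: levD; first exact: bl_lexx.
    apply: levN; apply: (@lev_trans _ _ (2^-1 ^+ i *: w)); last first.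
      by apply: levDr; exact: bl_scale_ge0.
    apply: (@lev_trans _ _ (2^-1 ^+ i *: (2^-1 ^+ j *: modulus (l j)))); last first.
      exact: lev_wscale.
    apply: (@lev_trans _ _ (4^-1 ^+ j *: modulus (l j))).
      by apply: lev_wscale => //; exact: lev_modulus.
    rewrite scalerA; apply: lev_scale_le (modulus_ge0 _).
    have -> : 4^-1 = 2^-1 * 2^-1 :> R by rewrite -invfM -natrM.
    rewrite exprMn ler_pM2r ?half_exp_gt0 //.
    by apply: ler_wiXn2l; [lra | lra | exact: ltnW].
  have vja : v j <=E 4 ^+ j *: pos (- a).
    rewrite -pos_scale //; apply: pos_mono.
    apply: (@lev_trans _ _ (l j - 4 ^+ j *: U j)).
      by apply: levB_le; exact: bl_scale_ge0.
    rewrite opprB scalerBr scalerA -exprMn divff ?expr1n ?scale1r; last by lra.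
    apply: levD; first exact: bl_lexx.
    apply: levN; apply: lev_wscale => //; apply: (lev_trans (lev_modulus _)).
    rewrite /U (bigD1 (Ordinal ij)) //=; apply: levDl.
    by apply: sumv_ge0 => k _; exact: modulus_ge0.
  apply: (disjoint_le (v0 i) via (v0 j) vja).
  rewrite -[pos a]scale1r; apply: disjoint_scale => //; try exact: pos_ge0.
  exact: meet_pos_neg.
have vl n : v n <=E pos (l n).
  apply: pos_mono; apply: lev_trans (levB_le _ _) (levB_le _ _);
  exact: bl_scale_ge0.
have vdis i j : i <> j -> bl_meet (v i) (v j) = 0.
  move=> /eqP; rewrite neq_ltn => /orP[ij|ji]; first exact: vd.
  by rewrite meetvC; exact: vd.
have e2 : 0 < e / 2 by rewrite divr_gt0.
have := Tnull v l lL v0 vl vdis; move=> /cvgr0Pnorm_lt/(_ _ e2)[N1 _ hN1].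
have := half_exp_cvg0 `|T w|; move=> /cvgr0Pnorm_lt/(_ _ e2)[N2 _ hN2].
pose n := maxn N1 N2.
have h1 := hN1 n (leq_maxl _ _); have h2 := hN2 n (leq_maxr _ _).
have : `|T (pos (l n - 4 ^+ n *: U n))| <= `|T (v n) + 2^-1 ^+ n *: T w|.
  rewrite -linearZ -linearD; apply: lev_norm; first by apply: T0; exact: pos_ge0.
  apply: positive_mono => //.
  rewrite -{1}[_ - 4 ^+ n *: U n](subrK (2^-1 ^+ n *: w)).
  apply: (lev_trans (posD _ _)); apply: levD; first exact: bl_lexx.
  by rewrite pos_id; [exact: bl_lexx | exact: bl_scale_ge0].
move: h1 h2 => /= h1; rewrite ger0_norm ?mulr_ge0 // => h2.
have := ler_normD (T (v n)) (2^-1 ^+ n *: T w).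
rewrite normrZ ger0_norm //; have := le n; move: h1 h2; lra.
Qed.

End disjointification.

(** * Order intervals without large disjoint sequences *)

Section LW_intervals.
Context (R : realType) (E : banachLatticeType R).

(** [[0, u]] is an LW-set; equivalently, the norm is order continuous on the
    ideal generated by [u]. *)
Definition LW_interval (u : E) := 0 <=E u /\
  forall v : nat -> E, (forall n, 0 <=E v n) -> (forall n, v n <=E u) ->
    (forall i j, i <> j -> bl_meet (v i) (v j) = 0) ->
    v @ \oo --> (0 : E).

(** Pointwise, the left-hand side vanishes where [z <= d * u] and is at most
    [d * u <= z] elsewhere. *)
Lemma meet_truncation (u z : E) (d C : R) : 0 <=E u -> 0 <=E z -> 0 <= d ->
  0 <= C -> d *: bl_meet u (C *: pos (z - d *: u)) <=E z.
Proof.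
move=> u0 z0 d0 C0; rewrite -meetv_scale // scalerA.
set q := pos _; pose q' := pos (- (z - d *: u)).
have duq : d *: u <=E z + q'.
  apply/levBr; rewrite addrAC -[_ - d *: u]posBpos -/q -/q' subrK.
  exact: pos_ge0.
apply: (lev_trans (lev_meet2 duq (bl_lexx _))); rewrite meetvC.
have dC : 0 <=E (d * C) *: q by apply: bl_scale_ge0 (pos_ge0 _); exact: mulr_ge0.
apply: (lev_trans (meetvDr dC z0 (pos_ge0 _))).
rewrite -[X in _ + bl_meet _ X]scale1r disjoint_scale ?mulr_ge0 // ?addr0.
- exact: lev_meetr.
- exact: pos_ge0.
- exact: pos_ge0.
- exact: meet_pos_neg.
Qed.

(** All the truncations from [N] on are dominated by finitely many of them, by
    disjointification; [meet_truncation] makes the constant [d^-1], whatever the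
    multiple of those finitely many truncations. *)
Lemma truncation_block (u : E) (z : nat -> E) (d e : R) (N : nat) :
  LW_interval u -> (forall n, 0 <=E z n) -> (forall n, z n <=E u) ->
  0 < d -> 0 < e ->
  exists2 M, (N <= M)%N & forall n, (N <= n)%N -> exists r,
    pos (z n - d *: u) <=E d^-1 *: \sum_(N <= i < M) z i + r /\ `|r| <= e.
Proof.
move=> [u0 uLW] z0 zu d0 e0; pose zd n := pos (z n - d *: u).
have zd0 n : 0 <=E zd n by exact: pos_ge0.
have zdu n : zd n <=E u.
  by apply: pos_le => //; apply: lev_trans (levB_le _ _) (zu n);
    apply: bl_scale_ge0 => //; exact: ltW.
pose L := [set zd i | i in [set i | (N <= i)%N]].
have [||s [sL sapp]] :=
  @approx_order_bounded R E idfun L `|u| e (fun x x0 => x0) _ _ e0.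
- by move=> _ [i _ <-]; exact: lev_norm.
- move=> v l lL v0 vl vd; apply: uLW => // n.
  apply: (lev_trans (vl n)); have [i _ <-] := lL n.
  by rewrite pos_id.
have sum_le (t : seq E) : (forall y, y \in t -> L y) ->
    exists M K, [/\ (N <= M)%N, 0 <= K :> R &
      \sum_(y <- t) modulus y <=E K *: \sum_(N <= i < M) zd i].
  elim: t => [_|y t ih yt].
    by exists N, 0; rewrite big_nil scale0r; split=> //; exact: bl_lexx.
  have [|M [K [NM K0 tle]]] := ih.
    by move=> x xt; apply: yt; rewrite inE xt orbT.
  have [i Ni iy] : L y by apply: yt; rewrite mem_head.
  have mono M1 M2 : (N <= M1)%N -> (M1 <= M2)%N ->
      \sum_(N <= j < M1) zd j <=E \sum_(N <= j < M2) zd j.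
    move=> h1 h2; rewrite (big_cat_nat h1 h2) /=; apply: levDl.
    by apply: sumv_ge0.
  exists (maxn M i.+1), (K + 1); split.
  - by rewrite leq_max NM.
  - exact: addr_ge0.
  - rewrite big_cons addrC scalerDl scale1r; apply: levD.
      apply: (lev_trans tle); apply: lev_wscale => //; apply: mono => //.
      exact: leq_maxl.
    rewrite -iy modulus_id //; apply: lev_trans (mono i.+1 _ _ _); last 2 first.
    - exact: leqW.
    - exact: leq_maxr.
    by rewrite big_nat_recr //=; apply: levDr; exact: sumv_ge0.
have [M [K [NM K0 sle]]] := sum_le s sL.
exists M => // n Nn.
set w := 4 ^+ size s *: \sum_(y <- s) modulus y in sapp.
exists (pos (zd n - w)); split; last by apply: sapp; exists n.
rewrite -/(zd n) -{1}(meet_posB (zd n) w); apply: levD; last exact: bl_lexx.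
have p40 : 0 <= 4 ^+ size s :> R by rewrite exprn_ge0.
apply: (@lev_trans _ _
    (bl_meet u (\sum_(N <= i < M) (4 ^+ size s * K) *: zd i))).
  apply: lev_meet2 => //; rewrite -scaler_sumr -scalerA; exact: lev_wscale.
apply: (lev_trans (meetv_sum _ u0 _)).
  by move=> i; apply: bl_scale_ge0 => //; exact: mulr_ge0.
rewrite scaler_sumr; apply: lev_sum => i _.
have dn0 : d != 0 by rewrite gt_eqF.
rewrite -[X in X <=E _](scalerK dn0).
apply: lev_wscale; first by rewrite invr_ge0 ltW.
apply: meet_truncation => //; [exact: ltW | exact: mulr_ge0].
Qed.

(** Along a sequence with bounded sums, the truncations of [z n] are dominated
    by each of [k] consecutive blocks, hence by a [k]-th of [u]. *)
Lemma LW_interval_bounded_sums (u : E) (z : nat -> E) :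
  LW_interval u -> (forall n, 0 <=E z n) ->
  (forall n, \sum_(i < n) z i <=E u) -> z @ \oo --> (0 : E).
Proof.
move=> uLW z0 zsum.
have zu n : z n <=E u.
  apply: lev_trans (zsum n.+1); rewrite big_ord_recr /=; apply: levDr.
  exact: sumv_ge0.
apply/cvgr0Pnorm_le => e e0.
pose d := e / (3 * (`|u| + 1)).
have u1 : 0 < `|u| + 1 by rewrite ltr_wpDl.
have d0 : 0 < d by rewrite divr_gt0 // mulr_gt0.
pose zd n := pos (z n - d *: u).
have blocks k : exists M, forall n, (M <= n)%N -> exists r,
    k%:R *: zd n <=E d^-1 *: \sum_(i < M) z i + r /\ `|r| <= k%:R * (e / 3).
  elim: k => [|k [M hM]].
    exists 0%N => n _; exists 0; rewrite big_ord0 scale0r scaler0 addr0 normr0 mul0r.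
    by split=> //; exact: bl_lexx.
  have [|M' MM' hM'] := truncation_block M uLW z0 zu d0 (_ : 0 < e / 3).
    by rewrite divr_gt0.
  exists M' => n M'n; have [r [hr re]] := hM n (leq_trans MM' M'n).
  have [r' [hr' re']] := hM' n (leq_trans MM' M'n).
  exists (r + r'); split.
    rewrite -natr1 scalerDl scale1r -(big_mkord xpredT z).
    rewrite (big_cat_nat (leq0n M) MM') /= big_mkord scalerDr addrACA.
    exact: levD.
  by rewrite -natr1 mulrDl mul1r (le_trans (ler_normD _ _)) // lerD.
pose k := (Num.truncn (d^-1 * `|u| * 3 / e)).+1.
have [M hM] := blocks k.
exists M => // n /= Mn; have [r [hr re]] := hM n Mn.
have k0 : 0 < k%:R :> R by rewrite ltr0n.
have zd_le : `|zd n| <= 2 * (e / 3).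
  rewrite -(ler_pM2l k0).
  have -> : k%:R * `|zd n| = `|k%:R *: zd n| by rewrite normrZ ger0_norm // ltW.
  apply: (@le_trans _ _ `|d^-1 *: u + r|).
    apply: lev_norm; first by apply: bl_scale_ge0 (pos_ge0 _); exact: ltW.
    apply: (lev_trans hr); apply: levD; last exact: bl_lexx.
    by apply: lev_wscale (zsum M); rewrite invr_ge0 ltW.
  apply: (le_trans (ler_normD _ _)); rewrite normrZ gtr0_norm ?invr_gt0 //.
  have : d^-1 * `|u| * 3 / e <= k%:R by exact: ltW (truncnS_gt _).
  rewrite ler_pdivrMr // => h; move: re h; lra.
have : `|z n| <= `|zd n + d *: u|.
  apply: lev_norm => //; rewrite -{1}(subrK (d *: u) (z n)).
  by apply: levD; [exact: lev_pos | exact: bl_lexx].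
move=> /le_trans; apply; apply: (le_trans (ler_normD _ _)).
rewrite normrZ gtr0_norm //.
have : d * `|u| <= e / 3.
  rewrite /d -mulrA ler_pM2l // invfM -mulrA ler_piMr // ?invr_ge0 //.
  by rewrite mulrC ler_pdivrMr // mul1r lerDl.
by move: zd_le; lra.
Qed.

(** The increments of a sequence that is not Cauchy have bounded sums. *)
Lemma LW_interval_monotone_cvg (u : E) (a : nat -> E) :
  LW_interval u -> (forall n, 0 <=E a n) -> (forall n, a n <=E u) ->
  (forall n, a n <=E a n.+1) -> cvgn a.
Proof.
move=> uLW a0 au an; apply/cauchy_cvgP/cauchy_exP => e e0.
apply: contrapT => /forallNP nball.
have far N : exists2 n, (N < n)%N & e <= `|a n - a N|.
  apply: contrapT => /forall2NP h; apply: (nball (a N)).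
  exists N => // n /= Nn; rewrite -ball_normE /= distrC.
  move: Nn; rewrite leq_eqVlt => /orP[/eqP ->|Nn]; first by rewrite subrr normr0.
  by have [//|/negP] := h n; rewrite -ltNge.
have [|nu [nui nuP]] := @dependent_subsequence (fun _ m m' => e <= `|a m' - a m|).
  by move=> _ m; exact: far.
pose z k := a (nu k.+1) - a (nu k).
have amono m n : (m <= n)%N -> a m <=E a n.
  elim: n => [|n ih]; first by rewrite leqn0 => /eqP ->; exact: bl_lexx.
  rewrite leq_eqVlt => /orP[/eqP ->|mn]; first exact: bl_lexx.
  exact: lev_trans (ih mn) (an n).
have z0 k : 0 <=E z k by apply/levBr; apply: amono; exact: ltnW.
have zsum n : \sum_(k < n) z k <=E u.
  suff -> : \sum_(k < n) z k = a (nu n) - a (nu 0%N).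
    exact: lev_trans (levB_le _ (a0 _)) (au _).
  by rewrite -(big_mkord xpredT z) telescope_sumr.
have := LW_interval_bounded_sums uLW z0 zsum.
move=> /cvgr0Pnorm_lt/(_ _ e0)[N _ /(_ N (leqnn N))].
by rewrite ltNge nuP.
Qed.

(** Let [F] be a positive functional above a multiple of a norming functional of
    each [g n]. Along a subsequence on which [F] is summable, [F] vanishes at the
    limit superior [t], hence so does every norming functional; but the suprema
    of the tails, which lie above the terms, converge to [t] in norm. *)
Lemma LW_interval_weak_null (u : E) (g : nat -> E) :
  LW_interval u -> (forall n, 0 <=E g n) -> (forall n, g n <=E u) ->
  (forall f : dual E, (forall x, 0 <=E x -> 0 <= sval f x :> R) ->
    (fun n => sval f (g n)) @ \oo --> (0 : R^o)) ->
  g @ \oo --> (0 : E).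
Proof.
move=> uLW g0 gu gnull; apply: contrapT.
move=> /not_cvg0_subsequence[e e0 [nu [nui nue]]].
have : forall n, exists f : dual E, [/\ forall y, 0 <=E y -> 0 <= sval f y :> R,
    forall y, `|sval f y| <= `|y| & sval f (g n) = `|g n|].
  by move=> n; exact: positive_norming_functional.
move=> /choice[f fP].
have f0 n x : 0 <=E x -> 0 <= sval (f n) x :> R by have [h _ _] := fP n; exact: h.
have f1 n x : `|sval (f n) x| <= `|x| by have [_ h _] := fP n.
have fg n : sval (f n) (g n) = `|g n| by have [] := fP n.
have h0 n := ltW (half_exp_gt0 R n).
pose p k : {linear E -> R^o} := (2^-1 ^+ k : R) \*: sval (f k).
have [|F _ FE] := @sum_functionals R E p (1 - 2^-1)^-1.
  move=> n x; apply: (@le_trans _ _ (\sum_(k < n) 2^-1 ^+ k * `|x|)).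
    apply: ler_sum => k _; rewrite /= normrZ ger0_norm //.
    by rewrite ler_wpM2l.
  by rewrite -mulr_suml ler_wpM2r // geometric_sum_le //; lra.
have Fge n x : 0 <=E x -> 2^-1 ^+ n * sval (f n) x <= sval F x :> R.
  move=> x0; apply: (cvgr_to_ge (FE x)); exists n.+1 => // m /= nm.
  rewrite (bigD1 (Ordinal nm)) //= lerDl; apply: sumr_ge0 => k _.
  by apply: mulr_ge0 => //; exact: f0.
have F0 x : 0 <=E x -> 0 <= sval F x :> R.
  by move=> x0; apply: le_trans (Fge 0%N x x0); rewrite mulr_ge0 // f0.
have Fmono x y : x <=E y -> sval F x <= sval F y :> R.
  by move=> /levBr/F0; rewrite linearB subr_ge0.
have [|mu [mui muP]] := @dependent_subsequence (fun k _ m' =>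
    sval F (g (nu m')) <= 2^-1 ^+ k :> R).
  move=> k m.
  have /cvgr0Pnorm_lt/(_ _ (half_exp_gt0 R k))[N _ hN] := gnull F F0.
  exists (maxn m.+1 N); first exact: leq_maxl.
  apply: (le_trans (ler_norm _)); apply/ltW/hN => /=.
  by apply: leq_trans (subsequence_ge nui _); exact: leq_maxr.
pose i k := nu (mu k.+1); pose G k := g (i k).
have FG k : sval F (G k) <= 2^-1 ^+ k :> R by exact: muP.
(* [J m l] is the supremum of [G m, .., G (m + l)]. *)
pose J m := nat_rect (fun=> E) (G m) (fun l Jl => bl_join Jl (G (m + l.+1)%N)).
have J0 m l : 0 <=E J m l.
  elim: l => [|l ih]; first exact: g0.
  exact: lev_trans ih (lev_joinl _ _).
have Ju m l : J m l <=E u.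
  by elim: l => [|l ih]; [exact: gu | apply: lev_join => //; exact: gu].
have FJ m l : sval F (J m l) <= 2^-1 ^+ m * (1 - 2^-1)^-1 :> R.
  apply: (@le_trans _ _ (\sum_(k < l.+1) 2^-1 ^+ m * 2^-1 ^+ k)); last first.
    by rewrite -mulr_sumr ler_wpM2l // geometric_sum_le //; lra.
  elim: l => [|l ih]; first by rewrite big_ord1 mulr1; exact: FG.
  rewrite big_ord_recr /=; apply: (@le_trans _ _ (sval F (J m l + G (m + l.+1)%N))).
    apply: Fmono; apply: lev_join; first by apply: levDl; exact: g0.
    by apply: levDr.
  by rewrite linearD; apply: lerD => //; rewrite -exprD; exact: FG.
have Fcvg (x : nat -> E) y : x @ \oo --> y ->
    (sval F \o x) @ \oo --> (sval F y : R^o).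
  by move=> xy; apply: (cvg_comp _ _ xy); exact: (svalP F).
have Jcvg m : cvgn (J m).
  by apply: (LW_interval_monotone_cvg uLW) => // l; exact: lev_joinl.
pose s m := limn (J m).
have sE m : J m @ \oo --> s m by exact: Jcvg.
have s0 m : 0 <=E s m by exact: pos_cvg_ge0 (sE m) (J0 m).
have su m : s m <=E u by exact: lev_cvg (sE m) (cvg_cst u) (Ju m).
have Gs m : G m <=E s m.
  apply: (lev_cvg (cvg_cst (G m)) (sE m)) => l.
  elim: l => [|l ih]; first exact: bl_lexx.
  exact: lev_trans ih (lev_joinl _ _).
have sdec m : s m.+1 <=E s m.
  have sE' : (fun l => J m (l + 1)%N) @ \oo --> s m.
    by rewrite (cvg_shiftn 1%N (J m)).
  apply: (lev_cvg (sE m.+1) sE') => l; rewrite addn1.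
  elim: l => [|l ih]; first by rewrite /= addn1; exact: lev_joinr.
  apply: lev_join; first exact: lev_trans ih (lev_joinl _ _).
  by rewrite addSnnS; exact: lev_joinr.
have Fs m : sval F (s m) <= 2^-1 ^+ m * (1 - 2^-1)^-1 :> R.
  by apply: (cvgr_to_le (Fcvg _ _ (sE m))); exists 0%N => // l _; exact: FJ.
have [t st] : exists t : E, s @ \oo --> t.
  have : cvgn (fun m => u - s m).
    apply: (LW_interval_monotone_cvg uLW) => m.
    - by apply/levBr.
    - exact: levB_le.
    - by apply: levD; [exact: bl_lexx | exact: levN].
  move=> /cvg_ex[t ut]; exists (u - t).
  have -> : s = (fun m => u - (u - s m)).
    by apply/funext => m; rewrite opprB addrC subrK.
  exact: cvgB (cvg_cst u) ut.
have t0 : 0 <=E t by exact: pos_cvg_ge0 st s0.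
have Ft : sval F t <= 0 :> R.
  have Fst : (fun m => sval F (s m)) @ \oo --> (0 : R^o).
    apply: (@squeeze_cvgr _ _ _ _ (fun=> 0) (fun m => 2^-1 ^+ m * (1 - 2^-1)^-1)).
    - by near=> m; rewrite Fs andbT; exact: F0.
    - exact: cvg_cst.
    - exact: half_exp_cvg0.
  by have -> : sval F t = 0 by exact: (cvg_unique _ (Fcvg _ _ st) Fst).
have ft n : sval (f n) t = 0.
  apply/eqP; rewrite eq_le f0 // andbT -(pmulr_rle0 _ (half_exp_gt0 R n)).
  exact: le_trans (Fge n t t0) Ft.
have /cvgrPdist_lt/(_ _ e0)[N _ /(_ N (leqnn N)) sN] := st.
have := nue (mu N.+1); rewrite leNgt => /negP; apply.
apply: le_lt_trans sN; rewrite distrC -fg -/(i N) -/(G N).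
apply: (@le_trans _ _ (sval (f (i N)) (s N - t))).
  by rewrite linearB ft subr0 -subr_ge0 -linearB; apply: f0; apply/levBr.
exact: le_trans (ler_norm _) (f1 _ _).
Unshelve. all: by end_near. Qed.

End LW_intervals.

(** * Almost LW operators *)

Section aLW_operators.
Context (R : realType) (E : banachLatticeType R).
Implicit Types (S T U V : {linear E -> E}) (W : set E).

Lemma bounded_setP (X : normedModType R) (L : set X) :
  bounded_set L <-> exists M : R, forall x, L x -> `|x| <= M.
Proof.
split=> [/pinfty_ex_gt0[M _ LM]|[M LM]]; first by exists M => x Lx; exact: LM.
exists M; split=> [|r Mr x /LM/le_trans]; first exact: num_real.
by apply; exact: ltW.
Qed.

(** Passing to moduli, only positive disjoint sequences matter. *)
Lemma LW_setP (L : set E) : LW_set L <-> bounded_set L /\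
  forall v x : nat -> E, (forall n, L (x n)) -> (forall n, 0 <=E v n) ->
    (forall n, v n <=E modulus (x n)) ->
    (forall i j, i <> j -> bl_meet (v i) (v j) = 0) -> v @ \oo --> (0 : E).
Proof.
split=> -[Lb Lnull]; split=> //.
  move=> v x Lx v0 vx vd; apply: Lnull.
    by move=> i j ij; rewrite !modulus_id //; exact: vd.
  by move=> _ [n _ <-]; exists (x n) => //; rewrite modulus_id.
move=> y yd yL.
have : forall n, exists x, L x /\ modulus (y n) <=E modulus x.
  by move=> n; have [|x Lx yx] := yL (y n); [exists n | exists x].
move=> /choice[x xP]; apply/norm_cvg0P.
under eq_fun do rewrite -norm_modulus.
apply/norm_cvg0P; apply: (Lnull _ x).
- by move=> n; exact: (xP n).1.
- by move=> n; exact: modulus_ge0.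
- by move=> n; exact: (xP n).2.
- by move=> i j ij; exact: yd.
Qed.

Lemma aLW_ext S T : S =1 T -> aLW S -> aLW T.
Proof.
move=> ST aS A cA; have -> : T @` A = S @` A; last exact: aS.
by apply: eq_imagel => x _; rewrite ST.
Qed.

(** By the Riesz decomposition, a disjoint sequence below the sums splits into
    two disjoint sequences below the summands. *)
Lemma aLWD S T : aLW S -> aLW T -> aLW (S \+ T).
Proof.
move=> aS aT A cA; have /LW_setP[Sb Snull] := aS A cA.
have /LW_setP[Tb Tnull] := aT A cA; apply/LW_setP; split.
  have /bounded_setP[M SM] := Sb; have /bounded_setP[N TN] := Tb.
  apply/bounded_setP; exists (M + N) => _ [x Ax <-].
  by apply: (le_trans (ler_normD _ _)); apply: lerD; [apply: SM|apply: TN]; exists x.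
move=> v y yL v0 vy vd.
have : forall n, exists x, A x /\ (S x + T x) = y n.
  by move=> n; have [x Ax <-] := yL n; exists x.
move=> /choice[x xP].
pose a n := bl_meet (v n) (modulus (S (x n))).
pose b n := pos (v n - modulus (S (x n))).
have a0 n : 0 <=E a n by apply: meetv_ge0 => //; exact: modulus_ge0.
have b0 n : 0 <=E b n by exact: pos_ge0.
have bv n : b n <=E v n by apply: pos_le => //; apply: levB_le; exact: modulus_ge0.
have cvg_a : a @ \oo --> (0 : E).
  apply: (Snull a (S \o x)) => //.
  - by move=> n; exists (x n) => //; exact: (xP n).1.
  - by move=> n; exact: lev_meetr.
  - move=> i j ij; apply: disjoint_le (vd i j ij) => //; exact: lev_meetl.
have cvg_b : b @ \oo --> (0 : E).
  apply: (Tnull b (T \o x)) => //.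
  - by move=> n; exists (x n) => //; exact: (xP n).1.
  - move=> n; apply: lev_posB; last exact: modulus_ge0.
    by apply: (lev_trans (vy n)); rewrite -(xP n).2; exact: modulusD.
  - by move=> i j ij; apply: disjoint_le (vd i j ij).
have -> : v = a \+ b by apply/funext => n; rewrite /= meet_posB.
by rewrite -[0]addr0; exact: cvgD.
Qed.

Lemma aLWZ (s : R) T : aLW T -> aLW (s \*: T).
Proof.
move=> aT A cA; have /LW_setP[Tb Tnull] := aT A cA; apply/LW_setP; split.
  have /bounded_setP[M TM] := Tb; apply/bounded_setP.
  exists (`|s| * M) => _ [x Ax <-].
  by rewrite /= normrZ ler_wpM2l //; apply: TM; exists x.
move=> v y yL v0 vy vd.
have : forall n, exists x, A x /\ s *: T x = y n.
  by move=> n; have [x Ax <-] := yL n; exists x.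
move=> /choice[x xP]; pose t := `|s| + 1.
have t0 : 0 < t by rewrite ltr_wpDl.
have tn0 : t != 0 by rewrite gt_eqF.
have -> : v = (fun n => t *: (t^-1 *: v n)) by apply/funext => n; rewrite scalerKV.
rewrite -[0](scaler0 _ t); apply: cvgZr.
have ti0 : 0 <= t^-1 by rewrite invr_ge0 ltW.
apply: (Tnull _ (T \o x)).
- by move=> n; exists (x n) => //; exact: (xP n).1.
- by move=> n; exact: bl_scale_ge0.
- move=> n; rewrite /= -[X in _ <=E X](scalerK tn0); apply: lev_wscale => //.
  apply: (lev_trans (vy n)); rewrite -(xP n).2 modulus_scale.
  by apply: lev_scale_le (modulus_ge0 _); rewrite lerDl.
- by move=> i j ij; apply: disjoint_scale => //; exact: vd.
Qed.

Lemma aLWB S T : aLW S -> aLW T -> aLW (S \- T).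
Proof.
move=> aS aT; apply: aLW_ext (aLWD aS (aLWZ (-1) aT)) => x.
by rewrite /= scaleN1r.
Qed.

Lemma aLW0 : aLW (\0 : {linear E -> E}).
Proof.
move=> A cA; apply/LW_setP; split.
  by apply/bounded_setP; exists 0 => _ [x _ <-]; rewrite normr0.
move=> v y yL v0 vy _; have -> : v = fun=> 0; last exact: cvg_cst.
apply/funext => n; apply: bl_le_anti => //; apply: (lev_trans (vy n)).
by have [x _ <-] := yL n; rewrite modulus_id; exact: bl_lexx.
Qed.

(** Positive operators are bounded, hence weakly continuous. *)
Lemma aLW_comp S T : aLW S -> positive_op T -> aLW (S \o T).
Proof.
move=> aS /positive_bounded[C _ TC] A cA.
rewrite -image_comp; apply: aS; exact: weakly_compact_image TC cA.
Qed.

Lemma aLW_LW_interval T u : positive_op T -> aLW T -> 0 <=E u ->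
  LW_interval (T u).
Proof.
move=> T0 aT u0; split; first exact: T0.
have /LW_setP[_ Tnull] := aT [set u] (weakly_compact_set1 u).
move=> v v0 vu vd; apply: (Tnull v (fun=> T u)) => // n; first by exists u.
exact: lev_trans (vu n) (lev_modulus _).
Qed.

(** The sequence [v] is weakly null, so that [T (v n)] is weakly null and runs
    through an LW-set. Disjointification puts it, up to small errors, into an
    interval [[0, w]] with [w] in the range of [T], where weakly null positive
    sequences are norm null. *)
Lemma aLW_disjoint_null T W (x v : nat -> E) : positive_op T -> aLW T ->
  relatively_weakly_compact W -> (forall n, W (x n)) ->
  (forall n, 0 <=E v n) -> (forall n, v n <=E pos (x n)) ->
  (forall i j, i <> j -> bl_meet (v i) (v j) = 0) ->
  (fun n => T (v n)) @ \oo --> (0 : E).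
Proof.
move=> T0 aT cW Wx v0 vx vd.
have vnull (f : dual E) : (fun n => sval f (v n)) @ \oo --> (sval f 0 : R^o).
  by rewrite linear0; exact: disjoint_weakly_null cW Wx v0 vx vd.
pose L := T @` range v.
have /LW_setP[/bounded_setP[M LM] Lnull] := aT _ (weakly_cvg_compact vnull).
have L_ge0 y : L y -> 0 <=E y by move=> [_ [n _ <-] <-]; exact: T0.
apply/cvgr0Pnorm_le => e e0; have e2 : 0 < e / 2 by rewrite divr_gt0.
have [|s [sL sapp]] :=
  @approx_order_bounded R E idfun L M (e / 2) (fun x x0 => x0) LM _ e2.
  move=> w l lL w0 wl wd; apply: (Lnull w l) => // n.
  exact: lev_trans (wl n) (pos_le_modulus _).
have [u u0 uE] : exists2 u, 0 <=E u & \sum_(y <- s) modulus y = T u.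
  elim: s sL {sapp} => [_|y s ih ys].
    by exists 0; [exact: bl_lexx | rewrite big_nil linear0].
  have [|u u0 uE] := ih; first by move=> z zs; apply: ys; rewrite inE zs orbT.
  have [|_ [n _ <-] yE] := ys y; first by rewrite mem_head.
  exists (v n + u); first exact: addv_ge0.
  by rewrite big_cons linearD uE -yE modulus_id //; exact: T0.
set w := 4 ^+ size s *: _ in sapp.
have wLW : LW_interval w.
  rewrite /w uE -linearZ; apply: aLW_LW_interval => //; apply: bl_scale_ge0 => //.
have w0 := wLW.1.
have meet_null : (fun n => bl_meet (T (v n)) w) @ \oo --> (0 : E).
  have m0 n : 0 <=E bl_meet (T (v n)) w by apply: meetv_ge0 => //; exact: T0.
  apply: (LW_interval_weak_null wLW) => //; first by move=> n; exact: lev_meetr.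
  move=> f f0; have [C _ TC] := positive_bounded T0.
  have [g gE] := dual_comp f TC.
  have gv : (fun n => sval g (v n)) @ \oo --> (0 : R^o).
    by have := vnull g; rewrite linear0.
  apply: (@squeeze_cvgr _ _ _ _ (fun=> 0) (fun n => sval g (v n))) => //.
    near=> n; rewrite f0 //= gE /= -subr_ge0 -linearB; apply: f0.
    by apply/levBr; exact: lev_meetl.
  exact: cvg_cst.
have /cvgr0Pnorm_le/(_ _ e2)[N _ hN] := meet_null.
exists N => // n /= Nn; rewrite -(meet_posB (T (v n)) w).
apply: (le_trans (ler_normD _ _)); rewrite [e]splitr; apply: lerD; first exact: hN.
by apply: sapp; exists (v n) => //; exists n.
Unshelve. all: by end_near. Qed.

(** The moduli of the vectors of a weakly compact set need not form a weakly
    compact set, but their images under a positive a-LW-operator are, up to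
    small errors, in one order interval without large disjoint sequences. *)
Lemma aLW_modulus_approx T W (e : R) : positive_op T -> aLW T ->
  relatively_weakly_compact W -> 0 < e ->
  exists2 b, LW_interval b &
    forall x, W x -> exists r, T (modulus x) <=E b + r /\ `|r| <= e.
Proof.
move=> T0 aT cW e0; have e2 : 0 < e / 2 by rewrite divr_gt0.
have half (K : set E) : relatively_weakly_compact K -> exists2 u, 0 <=E u &
    forall x, K x -> `|T (pos (x - u))| <= e / 2.
  move=> cK; have [M KM] := weakly_compact_bounded cK.
  have [|s [sK sapp]] := @approx_order_bounded R E T K M (e / 2) T0 KM _ e2.
    by move=> v l Kl v0 vl vd; exact: (aLW_disjoint_null T0 aT cK Kl v0 vl vd).
  exists (4 ^+ size s *: \sum_(y <- s) modulus y) => //.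
  apply: bl_scale_ge0; first by rewrite exprn_ge0.
  by apply: sumv_ge0 => y _; exact: modulus_ge0.
have [u u0 uW] := half W cW.
have cNW : relatively_weakly_compact ((\- idfun : {linear E -> E}) @` W).
  by apply: (@weakly_compact_image _ _ _ _ 1) cW => x; rewrite /= normrN mul1r.
have [w w0 wW] := half _ cNW.
exists (T (u + w)); first by apply: aLW_LW_interval => //; exact: addv_ge0.
move=> x Wx; exists (T (pos (x - u)) + T (pos (- x - w))); split.
  rewrite -2!(linearD T); apply: positive_mono => //; rewrite modulusE addrACA.
  have pos_le_add (y t : E) : 0 <=E t -> pos y <=E t + pos (y - t).
    move=> t0; apply: pos_le; last by apply: addv_ge0 => //; exact: pos_ge0.
    by rewrite addrC; apply/levBl; exact: lev_pos.
  by apply: levD; exact: pos_le_add.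
apply: (le_trans (ler_normD _ _)); rewrite [e]splitr; apply: lerD; first exact: uW.
by apply: wW; exists x.
Qed.

(** Sets close to LW-intervals are LW-sets, by the Riesz decomposition. *)
Lemma LW_set_approx (L : set E) :
  (forall e : R, 0 < e -> exists2 b, LW_interval b &
    forall x, L x -> exists r, modulus x <=E b + r /\ `|r| <= e) ->
  LW_set L.
Proof.
move=> h; apply/LW_setP; split.
  have [b _ bL] := h 1 ltr01; apply/bounded_setP; exists (`|b| + 1) => x Lx.
  have [r [xr r1]] := bL x Lx; apply: (le_trans (lev_modulus_norm xr)).
  by apply: (le_trans (ler_normD _ _)); rewrite lerD2l.
move=> v x Lx v0 vx vd; apply/cvgr0Pnorm_le => e e0.
have e2 : 0 < e / 2 by rewrite divr_gt0.
have [b [b0 bnull] bL] := h _ e2.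
have /cvgr0Pnorm_le/(_ _ e2)[N _ hN] : (fun n => bl_meet (v n) b) @ \oo --> (0 : E).
  have m0 n : 0 <=E bl_meet (v n) b by exact: meetv_ge0.
  apply: bnull => // [n|i j ij]; first exact: lev_meetr.
  by apply: (disjoint_le _ _ _ _ (vd i j ij)) => //; exact: lev_meetl.
exists N => // n /= Nn; rewrite -(meet_posB (v n) b).
apply: (le_trans (ler_normD _ _)); rewrite [e]splitr; apply: lerD; first exact: hN.
have [r [xr re]] := bL _ (Lx n); apply: le_trans re.
rewrite -[`|r|]norm_modulus; apply: lev_norm (pos_ge0 _) _.
apply: lev_posB (modulus_ge0 _); apply: (lev_trans (vx n)); apply: (lev_trans xr).
by apply: levD; [exact: bl_lexx | exact: lev_modulus].
Qed.

(** The bound of [aLW_modulus_approx] for [V] passes to [S], as [|S x| <= S |x|]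
    and weakly compact sets are bounded. *)
Lemma aLW_dominated S : positive_op S ->
  (forall e : R, 0 < e -> exists V U : {linear E -> E},
    [/\ positive_op V, aLW V, forall x, `|U x| <= e * `|x| &
      forall x, 0 <=E x -> S x <=E V x + U x]) ->
  aLW S.
Proof.
move=> S0 h A cA; apply: LW_set_approx => e e0.
have [M AM] := weakly_compact_bounded cA.
have M1 : 0 < `|M| + 1 by rewrite ltr_wpDl.
have [|V [U [V0 aV Ue SVU]]] := h (e / 2 / (`|M| + 1)).
  by rewrite divr_gt0 // divr_gt0.
have [|b bLW bA] := aLW_modulus_approx V0 aV cA (_ : 0 < e / 2).
  by rewrite divr_gt0.
exists b => // _ [x Ax <-]; have [r [Vr re]] := bA x Ax.
exists (r + U (modulus x)); split.
  apply: (lev_trans (positive_modulus x S0)).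
  apply: (lev_trans (SVU _ (modulus_ge0 x))); rewrite addrA.
  by apply: levD => //; exact: bl_lexx.
apply: (le_trans (ler_normD _ _)); rewrite [e]splitr; apply: lerD => //.
apply: (le_trans (Ue _)); rewrite norm_modulus mulrAC ler_pdivrMr //.
rewrite ler_pM2l ?divr_gt0 //; apply: (le_trans (AM x Ax)).
by apply: (le_trans (ler_norm M)); rewrite lerDl.
Qed.

Lemma aLW_le S V : positive_op S -> positive_op V -> aLW V ->
  (forall x, 0 <=E x -> S x <=E V x) -> aLW S.
Proof.
move=> S0 V0 aV SV; apply: aLW_dominated => // e e0; exists V, \0; split=> //.
  by move=> x; rewrite normr0 mulr_ge0 // ltW.
by move=> x x0; rewrite addr0; exact: SV.
Qed.

End aLW_operators.

(** * Regular operators *)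

Section regular_operators.
Context (R : realType) (E : banachLatticeType R).
Implicit Types (S T U V P : {linear E -> E}).

Lemma positive_opD (S T : E -> E) : positive_op S -> positive_op T ->
  positive_op (S \+ T).
Proof. by move=> S0 T0 x x0; apply: addv_ge0; [exact: S0 | exact: T0]. Qed.

Lemma positive_op_comp (S T : E -> E) : positive_op S -> positive_op T ->
  positive_op (S \o T).
Proof. by move=> S0 T0 x x0; apply: S0; exact: T0. Qed.

Lemma positive_opZ (s : R) (T : E -> E) : 0 <= s -> positive_op T ->
  positive_op (s \*: T).
Proof. by move=> s0 T0 x x0; apply: bl_scale_ge0 => //; exact: T0. Qed.

Lemma positive_regular T : positive_op T -> regular_op E T.
Proof.
move=> T0; exists T, \0; split=> //; first by move=> x _; exact: bl_lexx.
by apply/funext => x; rewrite /= subr0.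
Qed.

Lemma positive_raLW T : positive_op T -> aLW T -> raLW E T.
Proof.
move=> T0 aT; exists T, \0; split=> //; last by apply/funext => x; rewrite /= subr0.
by split; [move=> x _; exact: bl_lexx | exact: aLW0].
Qed.

Lemma raLW_aLW T : raLW E T -> aLW T.
Proof.
move=> [T1 [T2 [[_ a1] [_ a2] TE]]]; apply: aLW_ext (aLWB a1 a2) => x.
by rewrite TE.
Qed.

Lemma raLW_dominated T : raLW E T -> exists V,
  [/\ positive_op V, aLW V, op_le T V & op_le (\- T) V].
Proof.
move=> [T1 [T2 [[p1 a1] [p2 a2] TE]]]; exists (T1 \+ T2); split.
- exact: positive_opD.
- exact: aLWD.
- move=> x x0 /=; rewrite TE /= opprB addrC addrA subrK.
  by apply: addv_ge0; exact: p2.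
- move=> x x0 /=; rewrite TE /= opprK addrACA subrr addr0.
  by apply: addv_ge0; exact: p1.
Qed.

Lemma raLW_regular : raLW E `<=` regular_op E.
Proof. by move=> T [T1 [T2 [[p1 _] [p2 _] TE]]]; exists T1, T2. Qed.

Lemma raLWD S T : raLW E S -> raLW E T -> raLW E (S \+ T).
Proof.
move=> [S1 [S2 [[p1 a1] [p2 a2] SE]]] [T1 [T2 [[q1 b1] [q2 b2] TE]]].
exists (S1 \+ T1), (S2 \+ T2); split.
- by split; [exact: positive_opD | exact: aLWD].
- by split; [exact: positive_opD | exact: aLWD].
- by apply/funext => x /=; rewrite SE TE /= addrACA opprD.
Qed.

Lemma raLWZ (s : R) T : raLW E T -> raLW E (s \*: T).
Proof.
move=> [T1 [T2 [[p1 a1] [p2 a2] TE]]].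
have [s0|/ltW s0] := lerP 0 s.
  exists (s \*: T1), (s \*: T2); split.
  - by split; [exact: positive_opZ | exact: aLWZ].
  - by split; [exact: positive_opZ | exact: aLWZ].
  - by apply/funext => x /=; rewrite TE /= scalerBr.
have ns0 : 0 <= - s by rewrite oppr_ge0.
exists ((- s) \*: T2), ((- s) \*: T1); split.
- by split; [exact: positive_opZ | exact: aLWZ].
- by split; [exact: positive_opZ | exact: aLWZ].
- apply/funext => x /=; rewrite TE /= scalerBr !scaleNr opprK addrC.
  by [].
Qed.

Lemma raLW_ext S T : S =1 T -> raLW E S -> raLW E T.
Proof.
move=> ST [S1 [S2 [h1 h2 SE]]]; exists S1, S2; split=> //.
by rewrite -SE; apply/funext => x; rewrite ST.
Qed.

Lemma raLWN T : raLW E T -> raLW E (\- T).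
Proof. by move=> /(raLWZ (-1)); apply: raLW_ext => x /=; rewrite scaleN1r. Qed.

Lemma raLW_subspace : is_subspace (raLW E).
Proof.
split; [exact: raLW_regular | | exact: raLWD | exact: raLWZ].
by apply: positive_raLW; [move=> x _; exact: bl_lexx | exact: aLW0].
Qed.

Lemma raLW_subalgebra : is_subalgebra (raLW E).
Proof.
split=> [|S T]; first exact: raLW_subspace.
move=> [S1 [S2 [[p1 a1] [p2 a2] SE]]] [T1 [T2 [[q1 b1] [q2 b2] TE]]].
exists ((S1 \o T1) \+ (S2 \o T2)), ((S1 \o T2) \+ (S2 \o T1)); split.
- by split; [apply: positive_opD; exact: positive_op_comp
            | apply: aLWD; exact: aLW_comp].
- by split; [apply: positive_opD; exact: positive_op_comp
            | apply: aLWD; exact: aLW_comp].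
- apply/funext => x /=; rewrite SE TE /= (linearB S1) (linearB S2) opprB.
  by rewrite addrACA opprD.
Qed.

(** If the identity is a-LW, so is every positive operator composed with it;
    conversely the identity is itself regular. *)
Lemma raLW_full : raLW E = regular_op E <-> aLW (idfun : {linear E -> E}).
Proof.
split=> [full|aI].
  by apply: raLW_aLW; rewrite full; apply: positive_regular.
apply/seteqP; split; first exact: raLW_regular.
move=> T [T1 [T2 [p1 p2 TE]]].
have aP P : positive_op P -> aLW P.
  by move=> P0; apply: aLW_ext (aLW_comp aI P0).
by exists T1, T2; split=> //; split=> //; exact: aP.
Qed.

Lemma regular_pos_part T : dedekind_complete E -> regular_op E T ->
  exists P : {linear E -> E}, forall x, 0 <=E x ->
    (forall y, 0 <=E y -> y <=E x -> T y <=E P x) /\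
    (forall u, (forall y, 0 <=E y -> y <=E x -> T y <=E u) -> P x <=E u).
Proof.
move=> dE [T1 [T2 [p1 p2 TE]]].
have [||P PE] := @riesz_kantorovich R E E T setT dE.
- by split.
- move=> x x0; exists (T1 x) => y y0 yx _; rewrite TE /=.
  by apply: (lev_trans (levB_le _ (p2 y y0))); exact: positive_mono.
exists P => x x0; have [Pub Plub] := PE x x0; split=> [y y0 yx|u hu].
  exact: Pub.
by apply: Plub => y y0 yx _; exact: hu.
Qed.

(** The supremum is [S + (T - S)^+] and the infimum is [T - (T - S)^+]. *)
Lemma raLW_sublattice : dedekind_complete E -> is_sublattice (raLW E).
Proof.
move=> dE S T rS rT; have rTS := raLWD rT (raLWN rS).
have [P PE] := regular_pos_part dE (raLW_regular rTS).
have P0 : positive_op P.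
  move=> x x0; have := (PE x x0).1 0 (bl_lexx _) x0.
  by rewrite linear0.
have PTS x : 0 <=E x -> T x - S x <=E P x.
  by move=> x0; exact: ((PE x x0).1 x x0 (bl_lexx _)).
have Pmin V : positive_op V -> (forall x, 0 <=E x -> T x - S x <=E V x) ->
    forall x, 0 <=E x -> P x <=E V x.
  move=> V0 TSV x x0; apply: (PE x x0).2 => y y0 yx.
  by apply: (lev_trans (TSV y y0)); exact: positive_mono.
have aP : aLW P.
  have [V [V0 aV TSV _]] := raLW_dominated rTS.
  by apply: (aLW_le P0 V0 aV); apply: Pmin => // x x0; apply/levBr; exact: TSV.
have rP : raLW E P by exact: positive_raLW.
split.
  exists (S \+ P); first exact: raLWD.
  split; first by apply: raLW_regular; exact: raLWD.
  - by move=> x x0 /=; rewrite addrC addKr; exact: P0.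
  - by move=> x x0 /=; apply/levBr; rewrite addrC; apply/levBl; exact: PTS.
  - move=> V _ SV TV x x0 /=; apply/levBr; rewrite addrC; apply/levBrDr.
    apply: (Pmin (V \- S)) => // y y0; apply: levD; last exact: bl_lexx.
    by apply/levBr; exact: TV.
have rU := raLWD rT (raLWN rP).
exists (T \+ (\- P)) => //; split; first exact: raLW_regular.
- by move=> x x0 /=; apply/levBr/levBl; rewrite addrC; apply/levBl; exact: PTS.
- by move=> x x0 /=; rewrite opprB addrC subrK; exact: P0.
- move=> V _ VS VT x x0 /=; apply/levBr/levBrDr; rewrite addrC; apply/levBrDr.
  apply: (Pmin (T \- V)) => // y y0; apply: levD; first exact: bl_lexx.
  by apply: levN; apply/levBr; exact: VS.
Qed.

Lemma op_modulus_positive T U : op_le T U -> op_le (\- T) U -> positive_op U.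
Proof.
move=> TU NTU x x0; have h : 0 <=E 2^-1 *: (U x + U x).
  apply: bl_scale_ge0; first by rewrite invr_ge0.
  have := addv_ge0 (TU x x0) (NTU x x0).
  by rewrite /= opprK addrACA [- _ + _]addrC subrr addr0.
move: h; rewrite -mulr2n -(scaler_nat 2 (U x)) scalerA.
by rewrite mulVf ?scale1r // pnatr_eq0.
Qed.

(** [S] is the difference of [absS] and [absS - S], both between [0] and twice
    a positive a-LW-operator. *)
Lemma raLW_order_ideal : is_order_ideal (raLW E).
Proof.
split=> [|S T absS absT rS rT [_ SU NSU _] [_ _ _ Tmin] ST].
  exact: raLW_subspace.
have [V [V0 aV TV NTV]] := raLW_dominated rT.
have TabsV : op_le absT V by apply: Tmin => //; exact: positive_regular.
have absS0 := op_modulus_positive SU NSU.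
have SV x : 0 <=E x -> absS x <=E V x.
  move=> x0; apply: (@lev_trans _ _ (absT x)); apply/levBr;
  [exact: ST | exact: TabsV].
exists absS, (absS \- S); split.
- by split=> //; exact: aLW_le SV.
- split=> //; apply: (@aLW_le _ _ _ (V \+ V)) => //.
  + exact: positive_opD.
  + exact: aLWD.
  + move=> x x0 /=; apply: levD; first exact: SV.
    apply: (lev_trans _ (SV x x0)); have := NSU x x0.
    by move=> /= /levBr.
- by apply/funext => x /=; rewrite opprB addrC subrK.
Qed.

Lemma opnorm_has_sup (T : {linear E -> E}) : positive_op T ->
  has_sup [set `|T x| | x in [set x : E | `|x| <= 1]].
Proof.
move=> /positive_bounded[C C0 TC]; split.
  by exists `|T 0|; exists 0 => //=; rewrite normr0.
exists C => _ [x x1 <-]; apply: (le_trans (TC x)).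
by rewrite -[X in _ <= X]mulr1 ler_wpM2l.
Qed.

Lemma opnorm_ge0 (T : {linear E -> E}) : positive_op T -> 0 <= opnorm T.
Proof.
move=> T0; apply: (le_trans (normr_ge0 (T 0))).
by apply: (sup_upper_bound (opnorm_has_sup T0)); exists 0 => //=; rewrite normr0.
Qed.

Lemma opnorm_bound (T : {linear E -> E}) x : positive_op T ->
  `|T x| <= opnorm T * `|x|.
Proof.
move=> T0; have [->|x0] := eqVneq x 0; first by rewrite linear0 !normr0 mulr0.
have nx : 0 < `|x| by rewrite normr_gt0.
rewrite -ler_pdivrMr // mulrC -[`|x|^-1]gtr0_norm ?invr_gt0 // -normrZ -linearZ.
apply: (sup_upper_bound (opnorm_has_sup T0)); exists (`|x|^-1 *: x) => //=.
by rewrite normrZ gtr0_norm ?invr_gt0 // mulVf // gt_eqF.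
Qed.

Lemma opnorm_mono S T : positive_op S -> op_le S T -> opnorm S <= opnorm T.
Proof.
move=> S0 ST.
have T0 : positive_op T.
  by move=> x x0; apply: (lev_trans (S0 x x0)); apply/levBr; exact: ST.
apply: ge_sup; first by exists `|S 0|; exists 0 => //=; rewrite normr0.
move=> _ [x x1 <-]; apply: (@le_trans _ _ `|T (modulus x)|).
  apply: lev_modulus_norm; apply: (lev_trans (positive_modulus x S0)).
  by apply/levBr; apply: ST; exact: modulus_ge0.
by apply: (sup_upper_bound (opnorm_has_sup T0)); exists (modulus x) => //=;
  rewrite norm_modulus.
Qed.

Lemma inf_minimum (A : set R) a : A a -> lbound A a -> inf A = a.
Proof.
move=> Aa lba; apply/eqP; rewrite eq_le; apply/andP; split.
  by apply: ge_inf => //; exists a.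
by apply: lb_le_inf => //; exists a.
Qed.

(** Both infima are attained at the modulus of [T]. *)
Lemma raLW_norm_regular T : dedekind_complete E -> raLW E T ->
  raLW_norm T = regular_norm T.
Proof.
move=> dE rT.
have [[A rA [_ TA NTA Amin]] _] := raLW_sublattice dE rT (raLWN rT).
have A0 := op_modulus_positive TA NTA.
have le_opnorm U : op_le T U -> op_le (\- T) U -> opnorm A <= opnorm U.
  move=> TU NTU; apply: opnorm_mono => //; apply: Amin => //.
  exact: positive_regular (op_modulus_positive TU NTU).
rewrite /raLW_norm /regular_norm !(@inf_minimum _ (opnorm A)) //.
- by exists A.
- by move=> _ [U [TU NTU] <-]; exact: le_opnorm.
- by exists A => //; split=> //; exact: raLW_aLW.
- by move=> _ [U [TU NTU _] <-]; exact: le_opnorm.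
Qed.

(** If [S] is regularly a-LW and [U] dominates [T - S] up to sign, then both
    [T^+] and [T^-] are dominated by [U] plus a positive a-LW-operator. *)
Lemma raLW_closed : dedekind_complete E -> is_closed (raLW E).
Proof.
move=> dE T rT Tapp; have [P PE] := regular_pos_part dE rT.
have P0 : positive_op P.
  by move=> x x0; have := (PE x x0).1 0 (bl_lexx _) x0; rewrite linear0.
have PT x : 0 <=E x -> T x <=E P x.
  by move=> x0; exact: ((PE x x0).1 x x0 (bl_lexx _)).
have N0 : positive_op (P \- T) by move=> x x0; apply/levBr; exact: PT.
have approx e : 0 < e -> exists V U : {linear E -> E},
    [/\ positive_op V, aLW V, positive_op U, forall x, `|U x| <= e * `|x| &
      forall x, 0 <=E x -> T x <=E V x + U x /\ - T x <=E V x + U x].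
  move=> e0; have [S rS TSe] := Tapp e e0.
  have [V [V0 aV SV NSV]] := raLW_dominated rS.
  pose D := [set opnorm U | U in
    [set U : {linear E -> E} | op_le (T \- S) U /\ op_le (\- (T \- S)) U]].
  have D_inf : has_inf D.
    split; last first.
      by exists 0 => _ [U [h1 h2] <-]; apply: opnorm_ge0;
        exact: (@op_modulus_positive (T \- S)).
    have [T1 [T2 [p1 p2 TE]]] := rT.
    have V12 : positive_op (T1 \+ T2) by exact: positive_opD.
    have TB x : 0 <=E x -> T x <=E T1 x + T2 x /\ - T x <=E T1 x + T2 x.
      move=> x0; rewrite TE /= opprB; split.
        apply: levD; first exact: bl_lexx.
        by apply: (lev_trans _ (p2 x x0)); have := levN (p2 x x0); rewrite oppr0.
      rewrite addrC; apply: levD; last exact: bl_lexx.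
      by apply: (lev_trans _ (p1 x x0)); have := levN (p1 x x0); rewrite oppr0.
    exists (opnorm ((T1 \+ T2) \+ V)); exists ((T1 \+ T2) \+ V) => //.
    split=> x x0 /=; apply/levBr.
      apply: levD; first exact: (TB x x0).1.
      by apply/levBr; exact: (NSV x x0).
    rewrite opprB addrC; apply: levD; first exact: (TB x x0).2.
    by apply/levBr; exact: (SV x x0).
  have eD : 0 < e - inf D by rewrite subr_gt0.
  have [_ [U [TSU NTSU] <-] Ue] := inf_adherent eD D_inf.
  rewrite addrC subrK in Ue.
  have U0 : positive_op U by exact: (@op_modulus_positive (T \- S)).
  exists V, U; split=> // x.
    by apply: (le_trans (opnorm_bound x U0)); rewrite ler_wpM2r // ltW.
  move=> x0; split.
    rewrite -[T x](subrK (S x)) addrC; apply: levD; apply/levBr.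
      exact: SV.
    exact: TSU.
  rewrite -[- T x](addrK (S x)) addrC; apply: levD; apply/levBr.
    exact: NSV.
  by have := NTSU x x0; rewrite /= opprB [S x - T x]addrC.
have dominated (Q : {linear E -> E}) : positive_op Q ->
  (forall V : {linear E -> E}, positive_op V ->
    (forall x, 0 <=E x -> T x <=E V x /\ - T x <=E V x) ->
    forall x, 0 <=E x -> Q x <=E V x) -> aLW Q.
  move=> Q0 QV; apply: aLW_dominated => // e e0.
  have [V [U [V0 aV U0 Ue TVU]]] := approx e e0.
  exists V, U; split=> // x x0; apply: (QV (V \+ U)) => //.
  exact: positive_opD.
exists P, (P \- T); split; last by apply/funext => x /=; rewrite opprB addrC subrK.
- split=> //; apply: dominated => // V V0 TV x x0; apply: (PE x x0).2 => y y0 yx.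
  by apply: (lev_trans (TV y y0).1); exact: positive_mono.
- split=> //; apply: dominated => // V V0 TV x x0 /=; apply/levBl.
  apply: (PE x x0).2 => y y0 yx; apply/levBl; rewrite -linearB -[y - x]opprB linearN.
  have xy0 : 0 <=E x - y by apply/levBr.
  by apply: (lev_trans (TV _ xy0).2); apply: positive_mono => //; exact: levB_le.
Qed.

End regular_operators.

Theorem theorem2p2p5 (R : realType) (E : banachLatticeType R) :
  (is_subalgebra (raLW E) /\
   (raLW E = regular_op E <-> aLW (idfun : {linear E -> E}))) /\
  (dedekind_complete E ->
   [/\ is_riesz_subalgebra (raLW E),
       is_order_ideal (raLW E),
       forall T : {linear E -> E}, raLW E T -> raLW_norm T = regular_norm T
     & is_closed (raLW E)]).
Proof.
split=> [|dE]; first by split; [exact: raLW_subalgebra | exact: raLW_full].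
split.
- by split; [exact: raLW_subalgebra | exact: raLW_sublattice].
- exact: raLW_order_ideal.
- by move=> T; exact: raLW_norm_regular.
- exact: raLW_closed.
Qed.
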